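(* Let $(G,\tau)$ be a $\mathrm{TempEuler}(k)$ instance such that every two consecutive times at any edge differ by at most $u$. There is an algorithm that decides whether $(G,\tau)$ is temporally Eulerian in time $2^{\mathcal{O}(ku)}\Lambda$, where $\Lambda$ is the lifetime of the input.
   Context: A temporal graph is a pair $(G,\tau)$ where $G$ is a finite simple graph and $\tau: E(G)\to 2^{\mathbb{N}}$ assigns to each edge $e$ a finite set $\tau(e)$ of times at which $e$ is active; $(e,t)$ with $t\in\tau(e)$ is a time-edge. The lifetime is $\Lambda=\max_e\max\tau(e)$. A (strict) temporal $(x,y)$-walk is a sequence of time-edges $(e_1,t_1),\dots,(e_n,t_n)$ with $e_1,\dots,e_n$ a walk from $x$ to $y$ in $G$ and $t_1<\dots<t_n$; closed if $x=y$. A temporal Eulerian circuit is a closed temporal walk whose edge sequence is an Euler circuit of $G$; $(G,\tau)$ is temporally Eulerian if it has one. A $\mathrm{TempEuler}(k)$ instance is a temporal graph with $|\tau(e)|\le k$ for all $e$. ''Consecutive times'' at $e$ are elements $t<t'$ of $\tau(e)$ with no element of $\tau(e)$ strictly between them. *)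

(* Defs.v *)
From HB Require Import structures.
From mathcomp Require Import all_boot finmap.

Set Implicit Arguments.
Unset Strict Implicit.
Unset Printing Implicit Defensive.

(* The value of [tg_times] outside [tg_edges] is irrelevant. *)
Record temporal_graph (V : finType) := TemporalGraph {
  tg_edges : {set {set V}};
  tg_simple : forall e, e \in tg_edges -> #|e| = 2;
  tg_times : {set V} -> {fset nat}
}.

Section TemporalGraphs.
Variables (V : finType) (G : temporal_graph V).

(* 0 when there is no time-edge. *)
Definition lifetime : nat :=
  \max_(e in tg_edges G) \max_(t <- tg_times G e) t.

Fixpoint walk (x : V) (es : seq {set V}) (y : V) : Prop :=
  if es is e :: es' then
    e \in tg_edges G /\ exists2 z, e = [set x; z] & walk z es' y
  else x = y.

Definition temporal_walk (x y : V) (w : seq ({set V} * nat)) : Prop :=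
  [/\ walk x (unzip1 w) y,
      (forall et, et \in w -> et.2 \in tg_times G et.1)
    & sorted ltn (unzip2 w)].

Definition euler_circuit (es : seq {set V}) : Prop :=
  (exists x, walk x es x) /\
  (forall e, e \in tg_edges G -> count_mem e es = 1).

Definition temporal_euler_circuit (w : seq ({set V} * nat)) : Prop :=
  (exists x, temporal_walk x x w) /\ euler_circuit (unzip1 w).

Definition temporally_eulerian : Prop := exists w, temporal_euler_circuit w.

Definition temp_euler_instance (k : nat) : Prop :=
  forall e, e \in tg_edges G -> (#|` tg_times G e|)%fset <= k.

Definition consecutive_times (e : {set V}) (t t' : nat) : Prop :=
  [/\ t \in tg_times G e, t' \in tg_times G e, t < t'
    & forall s, s \in tg_times G e -> ~~ (t < s < t')].

Definition consecutive_gaps_at_most (u : nat) : Prop :=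
  forall e, e \in tg_edges G ->
  forall t t', consecutive_times e t t' -> t' - t <= u.

(* An input word lists the number of vertices, the number of edges and then,
   for each edge, its two endpoints, its number of times and its times.  The
   numbering of the vertices and all orderings are arbitrary: a graph has many
   encodings, and an algorithm has to cope with each of them. *)
Definition encode_edge (num : V -> nat) (r : V * V * seq nat) : seq nat :=
  [:: num r.1.1, num r.1.2, size r.2 & r.2].

Definition encodes (input : seq nat) : Prop :=
  exists (num : V -> nat) (rs : seq (V * V * seq nat)),
  [/\ injective num /\ (forall x, num x < #|V|),
      perm_eq [seq [set r.1.1; r.1.2] | r <- rs] (enum (tg_edges G)),
      (forall r, r \in rs -> perm_eq r.2 (tg_times G [set r.1.1; r.1.2]))
    & input = [:: #|V|, size rs & flatten (map (encode_edge num) rs)] ].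

End TemporalGraphs.

(* Uniform-cost random access machine, with structured control flow.  A program
   mentions finitely many registers and finitely many arrays, all holding
   natural numbers.  Addition and truncated subtraction are the only arithmetic
   operations; there is no multiplication, so that charging one unit for each
   operation, whatever the size of its operands, is the usual time measure. *)
Inductive expr : Type :=
| Const of nat
| Reg of nat
| Read of nat & expr  (* [Read a e] is cell [e] of array [a] *)
| Add of expr & expr
| Sub of expr & expr.

(* [If] and [While] test whether an expression is nonzero. *)
Inductive program : Type :=
| Skip
| Assign of nat & expr
| Write of nat & expr & expr  (* [Write a e1 e2] stores [e2] in cell [e1] of [a] *)
| Seq of program & program
| If of expr & program & program
| While of expr & program.

Record state := State { reg : nat -> nat; arr : nat -> nat -> nat }.

Fixpoint eval (s : state) (e : expr) : nat :=
  match e with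
  | Const n => n
  | Reg x => reg s x
  | Read a e1 => arr s a (eval s e1)
  | Add e1 e2 => eval s e1 + eval s e2
  | Sub e1 e2 => eval s e1 - eval s e2
  end.

Fixpoint expr_cost (e : expr) : nat :=
  match e with
  | Const _ | Reg _ => 1
  | Read _ e1 => (expr_cost e1).+1
  | Add e1 e2 | Sub e1 e2 => (expr_cost e1 + expr_cost e2).+1
  end.

Definition set_reg (s : state) (x v : nat) : state :=
  State (fun y => if y == x then v else reg s y) (arr s).

Definition set_arr (s : state) (a i v : nat) : state :=
  State (reg s)
    (fun b j => if (b == a) && (j == i) then v else arr s b j).

(* [exec p s n s']: run from [s], the program [p] halts in [s'] after exactly
   [n] time units. *)
Inductive exec : program -> state -> nat -> state -> Prop :=
| ExecSkip s : exec Skip s 1 s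
| ExecAssign x e s :
    exec (Assign x e) s (expr_cost e).+1 (set_reg s x (eval s e))
| ExecWrite a e1 e2 s :
    exec (Write a e1 e2) s (expr_cost e1 + expr_cost e2).+1
      (set_arr s a (eval s e1) (eval s e2))
| ExecSeq p q s s1 s2 m n :
    exec p s m s1 -> exec q s1 n s2 -> exec (Seq p q) s (m + n) s2
| ExecIfTrue e p q s s' n :
    eval s e != 0 -> exec p s n s' ->
    exec (If e p q) s (expr_cost e + n).+1 s'
| ExecIfFalse e p q s s' n :
    eval s e = 0 -> exec q s n s' ->
    exec (If e p q) s (expr_cost e + n).+1 s'
| ExecWhileTrue e p s s1 s2 m n :
    eval s e != 0 -> exec p s m s1 -> exec (While e p) s1 n s2 ->
    exec (While e p) s (expr_cost e + m + n).+1 s2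
| ExecWhileFalse e p s :
    eval s e = 0 -> exec (While e p) s (expr_cost e).+1 s.

(* The input word is in array 0; all other cells and all registers are 0. *)
Definition initial_state (input : seq nat) : state :=
  State (fun _ => 0) (fun a i => if a == 0 then nth 0 input i else 0).

Definition accepting (s : state) : Prop := reg s 0 != 0.

(* The program halts on [input] within [T] time units, and accepts exactly when
   [Q] holds. *)
Definition decides_within (p : program) (input : seq nat) (T : nat) (Q : Prop) :
    Prop :=
  exists (n : nat) (s : state),
    [/\ exec p (initial_state input) n s, n <= T & accepting s <-> Q].

(* Main.v *)
(* Write f(e) and l(e) for the first and last time of an edge e, and d for the
   largest l(e) - f(e); the gap condition gives d <= k u.  All edges e with
   f(e) <= t <= l(e) have to be used at distinct times of [t - d, t + d], so an
   instance in which more than 2d+1 edges straddle some t is rejected.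
   Otherwise sweep over the times t, keeping the trails that use only times
   below t and contain every edge with l(e) < t.  Such a trail leaves open only
   which of the straddling edges it has used, and by parity of degrees its end
   is determined by its start and its edge set; so one trail per start and edge
   set is enough.  The first edge of a circuit starts no later than any edge
   ends, which leaves at most 2(2d+1) candidate starts.  Hence 2^O(d) trails are
   kept at each time.  Edge sets are compared through their codes, sums of
   distinct powers of two (numbers with one bit per edge of the graph, which are
   added and compared in unit time), and membership of an edge e in a trail is
   tested by following the trail backwards until time f(e), which takes at most
   d steps. *)

Require Import Defs.
From mathcomp Require Import all_boot order finmap zify.
(* [all_boot] shadows the constructor [Sub] of [expr]. *)
Import Defs.

Set Implicit Arguments.
Unset Strict Implicit.
Unset Printing Implicit Defensive.

(** * Timed executions *)

Definition runs (p : program) (s : state) (T : nat) (Q : state -> Prop) : Prop :=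
  exists n s', [/\ exec p s n s', n <= T & Q s'].

Fixpoint reg_mods (p : program) : seq nat :=
  match p with
  | Assign x _ => [:: x]
  | Seq p q | If _ p q => reg_mods p ++ reg_mods q
  | While _ p => reg_mods p
  | _ => [::]
  end.

Fixpoint arr_mods (p : program) : seq nat :=
  match p with
  | Write a _ _ => [:: a]
  | Seq p q | If _ p q => arr_mods p ++ arr_mods q
  | While _ p => arr_mods p
  | _ => [::]
  end.

Definition framed (p : program) (s s' : state) : Prop :=
  (forall x, x \notin reg_mods p -> reg s' x = reg s x) /\
  (forall a, a \notin arr_mods p -> arr s' a =1 arr s a).

Lemma framed_reg p s s' (fr : framed p s s') x :
  x \notin reg_mods p -> reg s' x = reg s x.
Proof. by case: fr => eq_reg _; exact: eq_reg. Qed.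

Lemma framed_arr p s s' (fr : framed p s s') a i :
  a \notin arr_mods p -> arr s' a i = arr s a i.
Proof. by case: fr => _ eq_arr /eq_arr. Qed.

Arguments framed_reg {p s s'} fr x _.
Arguments framed_arr {p s s'} fr a i _.

Lemma framed_refl p s : framed p s s.
Proof. by []. Qed.

Lemma framed_trans p s1 s2 s3 :
  framed p s1 s2 -> framed p s2 s3 -> framed p s1 s3.
Proof.
move=> fr1 fr2; split=> [x ?|a ? i].
  by rewrite (framed_reg fr2) // (framed_reg fr1).
by rewrite (framed_arr fr2) // (framed_arr fr1).
Qed.

Lemma framed_mods_cat p q r s s' :
  framed p s s' \/ framed q s s' ->
  reg_mods r = reg_mods p ++ reg_mods q -> arr_mods r = arr_mods p ++ arr_mods q ->
  framed r s s'.
Proof.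
rewrite /framed => fr -> ->.
by case: fr => -[eq_reg eq_arr]; split=> z;
  rewrite mem_cat negb_or => /andP[zp zq]; rewrite ?eq_reg //; exact: eq_arr.
Qed.

Lemma exec_framed p s n s' : exec p s n s' -> framed p s s'.
Proof.
elim=> {p s n s'} //=.
- by move=> x e s; split=> //= y; rewrite inE => /negbTE->.
- by move=> a e1 e2 s; split=> //= b + i; rewrite inE => /negbTE->.
- move=> p q s s1 s2 m n _ fr1 _ fr2; apply: (@framed_trans _ _ s1).
    by apply: (@framed_mods_cat p q); first by left.
  by apply: (@framed_mods_cat p q); first by right.
- by move=> e p q s s' n _ _ fr; apply: (@framed_mods_cat p q); first by left.
- by move=> e p q s s' n _ _ fr; apply: (@framed_mods_cat p q); first by right.
- by move=> e p s s1 s2 m n _ _ fr1 _; exact: framed_trans.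
Qed.

Definition supported (xs bs : seq nat) (P : state -> Prop) : Prop :=
  forall s s', {in xs, reg s' =1 reg s} -> {in bs, forall a, arr s' a =1 arr s a} ->
  P s -> P s'.

Lemma supported_weaken xs bs xs' bs' P :
  all (mem xs') xs && all (mem bs') bs -> supported xs bs P -> supported xs' bs' P.
Proof.
move=> /andP[/allP sub_xs /allP sub_bs] suppP s s' eq_reg eq_arr; apply: suppP.
  by move=> x /sub_xs/eq_reg.
by move=> a /sub_bs/eq_arr.
Qed.

Definition untouched (p : program) (xs bs : seq nat) : bool :=
  all (fun x => x \notin reg_mods p) xs && all (fun a => a \notin arr_mods p) bs.

Lemma framed_supported xs bs P p s s' :
  supported xs bs P -> framed p s s' -> untouched p xs bs -> P s -> P s'.
Proof.
move=> suppP [eq_reg eq_arr] /andP[/allP regs /allP arrs]; apply: suppP.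
  by move=> x /regs/eq_reg.
by move=> a /arrs/eq_arr.
Qed.

Lemma runs_weaken p s T T' (Q Q' : state -> Prop) :
  runs p s T Q -> (forall s', framed p s s' -> Q s' -> Q' s') -> T <= T' ->
  runs p s T' Q'.
Proof.
case=> n [s' [ex nT Qs']] QQ' TT'; exists n, s'; split=> //.
  exact: leq_trans TT'.
exact: QQ' (exec_framed ex) Qs'.
Qed.

Lemma runs_seq p q s T1 T2 T (Q1 Q : state -> Prop) :
  runs p s T1 Q1 ->
  (forall s1, framed p s s1 -> Q1 s1 -> runs q s1 T2 Q) ->
  T1 + T2 <= T -> runs (Seq p q) s T Q.
Proof.
case=> m [s1 [ex1 mT1 Q1s1]] runs_q leT.
have [n [s2 [ex2 nT2 Qs2]]] := runs_q _ (exec_framed ex1) Q1s1.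
exists (m + n), s2; split=> //; first exact: ExecSeq ex1 ex2.
by apply: leq_trans leT; rewrite leq_add.
Qed.

Lemma runs_if e p q s T T' (Q : state -> Prop) :
  (eval s e != 0 -> runs p s T Q) -> (eval s e = 0 -> runs q s T Q) ->
  expr_cost e + T < T' -> runs (If e p q) s T' Q.
Proof.
move=> runs_p runs_q leT'; case: (eqVneq (eval s e) 0) => [e0|e1].
  have [n [s' [ex nT Qs']]] := runs_q e0.
  exists (expr_cost e + n).+1, s'; split=> //; first exact: ExecIfFalse.
  by apply: leq_trans leT'; rewrite ltnS leq_add2l.
have [n [s' [ex nT Qs']]] := runs_p e1.
exists (expr_cost e + n).+1, s'; split=> //; first exact: ExecIfTrue.
by apply: leq_trans leT'; rewrite ltnS leq_add2l.
Qed.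

(* The invariant [I k] carries a bound [k] on the number of iterations to come. *)
Lemma runs_while e p (I : nat -> state -> Prop) C T (Q : state -> Prop) n s :
  I n s ->
  (forall k s1, framed p s s1 -> I k s1 -> eval s1 e != 0 ->
     0 < k /\ runs p s1 C (I k.-1)) ->
  (forall k s1, framed p s s1 -> I k s1 -> eval s1 e = 0 -> Q s1) ->
  n * (expr_cost e + C).+1 + expr_cost e < T ->
  runs (While e p) s T Q.
Proof.
move=> In body exit ltT.
apply: (runs_weaken (T := n * (expr_cost e + C).+1 + (expr_cost e).+1) (Q := Q)) => //;
  last by rewrite addnS.
suff loop k s1 : framed p s s1 -> I k s1 ->
    runs (While e p) s1 (k * (expr_cost e + C).+1 + (expr_cost e).+1) Q.
  by apply: loop In; exact: framed_refl.
elim: k s1 => [|k IH] s1 fr Ik; case: (eqVneq (eval s1 e) 0) => e0.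
- by exists (expr_cost e).+1, s1; split;
    [exact: ExecWhileFalse|rewrite leq_addl|exact: exit Ik e0].
- by have [] := body _ _ fr Ik e0.
- by exists (expr_cost e).+1, s1; split;
    [exact: ExecWhileFalse|rewrite leq_addl|exact: exit Ik e0].
- have [_ [m [s2 [ex mC Ik']]]] := body _ _ fr Ik e0.
  have [m' [s3 [ex' m'T Qs3]]] := IH _ (framed_trans fr (exec_framed ex)) Ik'.
  exists (expr_cost e + m + m').+1, s3; split=> //; first exact: ExecWhileTrue ex ex'.
  by rewrite mulSn; lia.
Qed.

Lemma runs_while_seq A (L : seq A) e p (I : seq A -> seq A -> state -> Prop)
    C T (Q : state -> Prop) s :
  I [::] L s ->
  (forall done x todo s1, framed p s s1 -> L = done ++ x :: todo ->
     I done (x :: todo) s1 ->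
     eval s1 e != 0 /\ runs p s1 C (I (rcons done x) todo)) ->
  (forall s1, framed p s s1 -> I L [::] s1 -> eval s1 e = 0 /\ Q s1) ->
  size L * (expr_cost e + C).+1 + expr_cost e < T ->
  runs (While e p) s T Q.
Proof.
move=> I0 body exit.
pose J k s1 := exists done todo, [/\ L = done ++ todo, k = size todo & I done todo s1].
apply: (runs_while (I := J)); first by exists [::], L.
  move=> _ s1 fr [done [[|x todo] [eqL -> Is1]]] e0.
    by rewrite cats0 in eqL; subst done; have [e1 _] := exit _ fr Is1; rewrite e1 in e0.
  have [_ run] := body _ _ _ _ fr eqL Is1; split=> //.
  apply: runs_weaken run _ (leqnn _) => s2 _ Is2.
  by exists (rcons done x), todo; rewrite cat_rcons.
move=> _ s1 fr [done [[|x todo] [eqL _ Is1]]] e0.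
  by rewrite cats0 in eqL; subst done; have [] := exit _ fr Is1.
by have [/eqP] := body _ _ _ _ fr eqL Is1.
Qed.

Lemma runs_while_upto n e p (I : nat -> state -> Prop) C T (Q : state -> Prop) s :
  I 0 s ->
  (forall i s1, framed p s s1 -> i < n -> I i s1 ->
     eval s1 e != 0 /\ runs p s1 C (I i.+1)) ->
  (forall s1, framed p s s1 -> I n s1 -> eval s1 e = 0 /\ Q s1) ->
  n * (expr_cost e + C).+1 + expr_cost e < T ->
  runs (While e p) s T Q.
Proof.
move=> I0 body exit ltT.
apply: (runs_while_seq (L := iota 0 n) (I := fun done _ => I (size done)) (C := C));
  rewrite ?size_iota //.
  move=> done i todo s1 fr eqL Is1; rewrite size_rcons; apply: body => //.
  by rewrite -(size_iota 0 n) eqL size_cat /= -addSnnS leq_addr.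
Qed.

Fixpoint loop_free (p : program) : bool :=
  match p with
  | Seq p q | If _ p q => loop_free p && loop_free q
  | While _ _ => false
  | _ => true
  end.

Fixpoint run_loop_free (p : program) (s : state) : state :=
  match p with
  | Skip | While _ _ => s
  | Assign x e => set_reg s x (eval s e)
  | Write a e1 e2 => set_arr s a (eval s e1) (eval s e2)
  | Seq p q => run_loop_free q (run_loop_free p s)
  | If e p q => if eval s e == 0 then run_loop_free q s else run_loop_free p s
  end.

Fixpoint loop_free_cost (p : program) : nat :=
  match p with
  | Skip | While _ _ => 1
  | Assign _ e => (expr_cost e).+1
  | Write _ e1 e2 => (expr_cost e1 + expr_cost e2).+1
  | Seq p q => loop_free_cost p + loop_free_cost q
  | If e p q => (expr_cost e + (loop_free_cost p + loop_free_cost q)).+1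
  end.

Lemma runs_loop_free p s T (Q : state -> Prop) :
  loop_free p -> Q (run_loop_free p s) -> loop_free_cost p <= T -> runs p s T Q.
Proof.
move=> lf Qs leT.
apply: (runs_weaken (T := loop_free_cost p) (Q := Q)) => {leT} //.
elim: p s Q lf Qs => //=.
- by move=> s Q _ Qs; exists 1, s; split=> //; exact: ExecSkip.
- by move=> x e s Q _ Qs; eexists _, _; split; [exact: ExecAssign| |].
- by move=> a e1 e2 s Q _ Qs; eexists _, _; split; [exact: ExecWrite| |].
- move=> p IHp q IHq s Q /andP[lfp lfq] Qs.
  apply: (runs_seq (Q1 := eq^~ (run_loop_free p s))) (leqnn _); first exact: IHp.
  by move=> s1 _ ->; exact: IHq.
- move=> e p IHp q IHq s Q /andP[lfp lfq] Qs; apply: runs_if (leqnn _) => e0.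
    apply: runs_weaken (IHp s Q lfp _) _ (leq_addr _ _) => //.
    by rewrite (negbTE e0) in Qs.
  apply: runs_weaken (IHq s Q lfq _) _ (leq_addl _ _) => //.
  by rewrite e0 in Qs.
Qed.

Lemma run_loop_free_framed p s : loop_free p -> framed p s (run_loop_free p s).
Proof.
move=> lf; have [n [s' [/exec_framed fr _ <-]]] //:
  runs p s (loop_free_cost p) (eq^~ (run_loop_free p s)).
exact: runs_loop_free.
Qed.

Lemma runs_seq_loop_free p q s T T2 (Q : state -> Prop) :
  loop_free p ->
  (forall s1, framed p s s1 -> s1 = run_loop_free p s -> runs q s1 T2 Q) ->
  loop_free_cost p + T2 <= T ->
  runs (Seq p q) s T Q.
Proof.
move=> lf; apply: (runs_seq (Q1 := eq^~ (run_loop_free p s))).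
exact: runs_loop_free.
Qed.

(** * Numbered instances *)

Lemma iota_rcons i n : iota i n.+1 = rcons (iota i n) (i + n).
Proof. by rewrite -addn1 iotaD cats1. Qed.

Lemma big_rcons_AC R (op : R -> R -> R) x T (s : seq T) y (F : T -> R) :
  associative op -> commutative op ->
  \big[op/x]_(i <- rcons s y) F i = op (\big[op/x]_(i <- s) F i) (F y).
Proof.
move=> opA opC; elim: s => [|z s IH]; first by rewrite /= big_cons !big_nil opC.
by rewrite rcons_cons !big_cons IH opA.
Qed.

Lemma head_in (s : seq nat) : s != [::] -> head 0 s \in s.
Proof. by case: s => // x s _; exact: mem_head. Qed.

Lemma uniq_map_inj (T T' : eqType) (f : T -> T') (s : seq T) :
  uniq (map f s) -> {in s &, injective f}.
Proof.
elim: s => //= x s IH /andP[xs us] y z; rewrite !inE.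
move=> /orP[/eqP->|ys] /orP[/eqP->|zs] // eqf; last exact: IH.
  by rewrite eqf map_f in xs.
by rewrite -eqf map_f in xs.
Qed.

Lemma binary_lt n (f : nat -> bool) : \sum_(i < n) f i * 2 ^ i < 2 ^ n.
Proof.
elim: n => [|n IH]; first by rewrite big_ord0.
by rewrite big_ord_recr /= expnS mul2n -addnn -addSn leq_add //; case: (f n);
  rewrite ?mul1n.
Qed.

Lemma binary_inj n (f g : nat -> bool) :
  \sum_(i < n) f i * 2 ^ i = \sum_(i < n) g i * 2 ^ i ->
  forall i, i < n -> f i = g i.
Proof.
elim: n => // n IH; rewrite !big_ord_recr /= => eqs.
have fn := binary_lt n f; have gn := binary_lt n g.
have fg : f n = g n.
  move: eqs fn gn; move: (2 ^ n) (\sum_(i < n) _) (\sum_(i < n) _) => p a b.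
  by case: (f n); case: (g n) => //; lia.
move=> i; rewrite ltnS leq_eqVlt => /orP[/eqP->//|]; apply: IH.
by move: eqs; rewrite fg => /addIn.
Qed.

Lemma sum_exp2E n (s : seq nat) : uniq s -> {in s, forall e, e < n} ->
  \sum_(e <- s) 2 ^ e = \sum_(i < n) (val i \in s) * 2 ^ i.
Proof.
move=> us lt_n; have perm_s : perm_eq s [seq i <- iota 0 n | i \in s].
  apply: uniq_perm => //; first by rewrite filter_uniq ?iota_uniq.
  move=> e; rewrite mem_filter mem_iota /=.
  by case: (boolP (e \in s)) => //= /lt_n ->.
rewrite (perm_big _ perm_s) big_filter -[n in iota _ n]subn0 -/(index_iota 0 n).
by rewrite big_mkord big_mkcond; apply: eq_bigr => i _; case: (_ \in s); lia.
Qed.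

Lemma sum_exp2_lt n (s : seq nat) : uniq s -> {in s, forall e, e < n} ->
  \sum_(e <- s) 2 ^ e < 2 ^ n.
Proof. by move=> us /(sum_exp2E us)->; exact: (binary_lt n (mem s)). Qed.

Lemma sum_exp2_inj n (s s' : seq nat) :
  uniq s -> {in s, forall e, e < n} -> uniq s' -> {in s', forall e, e < n} ->
  \sum_(e <- s) 2 ^ e = \sum_(e <- s') 2 ^ e -> s =i s'.
Proof.
move=> us lt_n us' lt_n'; rewrite (sum_exp2E us lt_n) (sum_exp2E us' lt_n').
move=> /(@binary_inj n (mem s) (mem s')) eq_mem e; case: (ltnP e n) => [/eq_mem //|ge].
by apply/idP/idP => [/lt_n|/lt_n']; rewrite ltnNge ge.
Qed.

Local Notation search_record := (nat * seq (nat * nat))%type.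

Section Instance.

Variable es : seq (nat * nat * seq nat).

Local Notation m := (size es).

Definition edge i := nth (0, 0, [::]) es i.
Definition end1 i := (edge i).1.1.
Definition end2 i := (edge i).1.2.
Definition times i := (edge i).2.
Definition first_time i := \big[minn/head 0 (times i)]_(t <- times i) t.
Definition last_time i := \big[maxn/head 0 (times i)]_(t <- times i) t.

Lemma first_time_le i t : t \in times i -> first_time i <= t.
Proof.
rewrite /first_time -minEnat => t_in.
exact: (Order.TotalTheory.ge_bigmin_seq _ _ xpredT id t_in).
Qed.

Lemma last_time_ge i t : t \in times i -> t <= last_time i.
Proof.
rewrite /last_time -maxEnat => t_in.
exact: (Order.TotalTheory.le_bigmax_seq _ _ xpredT id t_in).
Qed.

Lemma first_time_in i : times i != [::] -> first_time i \in times i.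
Proof.
move=> ne; rewrite /first_time big_seq.
apply: (big_ind (fun t => t \in times i)) => // [|x y]; first exact: head_in.
by case: (leqP x y).
Qed.

Lemma last_time_in i : times i != [::] -> last_time i \in times i.
Proof.
move=> ne; rewrite /last_time big_seq.
apply: (big_ind (fun t => t \in times i)) => // [|x y]; first exact: head_in.
by case: (leqP x y).
Qed.

Definition straddles t i := first_time i <= t <= last_time i.

Lemma first_le_last i : times i != [::] -> first_time i <= last_time i.
Proof. by move/last_time_in/first_time_le. Qed.

(* Latest edge first: the order of the linked lists of the program. *)
Definition active n t := [seq i <- rev (iota 0 n) | t \in times i].
Definition coverage n t := count (straddles t) (iota 0 n).
Definition max_span n := \max_(i < n) (last_time i - first_time i).
Definition horizon n := \max_(i < n) (last_time i).+1.

Lemma activeS n t :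
  active n.+1 t = if t \in times n then n :: active n t else active n t.
Proof. by rewrite /active iota_rcons rev_rcons. Qed.

Lemma coverageS n t : coverage n.+1 t = coverage n t + straddles t n.
Proof. by rewrite /coverage iota_rcons -cats1 count_cat /= addn0. Qed.

Lemma mem_active n t e : (e \in active n t) = (e < n) && (t \in times e).
Proof. by rewrite mem_filter mem_rev mem_iota andbC. Qed.

Lemma active_uniq n t : uniq (active n t).
Proof. by rewrite filter_uniq ?rev_uniq ?iota_uniq. Qed.

Lemma size_active_le n t : size (active n t) <= coverage n t.
Proof.
rewrite size_filter count_rev; apply: sub_count => e te.
by rewrite /= /straddles first_time_le ?last_time_ge.
Qed.

Lemma span_le_max_span n i : i < n -> last_time i - first_time i <= max_span n.
Proof. by move=> lt; apply: (leq_bigmax (Ordinal lt)). Qed.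

Lemma lt_horizon n i : i < n -> last_time i < horizon n.
Proof. by move=> lt; apply: (leq_bigmax (Ordinal lt)). Qed.

Lemma leq_sum_coverage n N :
  (forall i, i < n -> first_time i <= last_time i < N) ->
  n <= \sum_(t < N) coverage n t.
Proof.
elim: n => // n IH times_lt; under eq_bigr => t _ do rewrite coverageS.
rewrite big_split /= -addn1 leq_add //.
  by apply: IH => i lt; apply: times_lt; exact: ltnW.
have /andP[first_last last_N] := times_lt n (ltnSn n).
rewrite (bigD1 (Ordinal (leq_ltn_trans first_last last_N))) //=.
by rewrite /straddles leqnn first_last.
Qed.

(** * Temporal trails *)

Definition incident e v := (v == end1 e) || (v == end2 e).

(* The other end of [e], provided that [v] is an end of [e]. *)
Definition opposite e v := end1 e + end2 e - v.

(* Trails are lists of pairs (edge, time), with the last step first. *)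
Fixpoint endpoint (x : nat) (w : seq (nat * nat)) : nat :=
  if w is et :: w' then opposite et.1 (endpoint x w') else x.

Fixpoint trail (x : nat) (w : seq (nat * nat)) : bool :=
  if w is et :: w' then
    [&& et.1 < m, et.2 \in times et.1, incident et.1 (endpoint x w'),
        et.1 \notin unzip1 w', all (fun t => t < et.2) (unzip2 w') & trail x w']
  else true.

Definition eulerian_trail x w := [/\ trail x w, size w = m & endpoint x w = x].

Lemma trail_uniq x w : trail x w -> uniq (unzip1 w).
Proof. by elim: w => //= et w IH /and5P[_ _ _ -> /andP[_ /IH]]. Qed.

Lemma trail_lt x w e : trail x w -> e \in unzip1 w -> e < m.
Proof.
elim: w => //= et w IH /and5P[lt _ _ _ /andP[_ tr]].
by rewrite inE => /orP[/eqP->|/(IH tr)].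
Qed.

Lemma trail_uniq_times x w : trail x w -> uniq (unzip2 w).
Proof.
elim: w => //= et w IH /and5P[_ _ _ _ /andP[/allP lt_et /IH->]]; rewrite andbT.
by apply/negP => /lt_et; rewrite ltnn.
Qed.

Lemma trail_times x w et : trail x w -> et \in w -> et.2 \in times et.1.
Proof.
elim: w => //= et' w IH /and5P[_ t_in _ _ /andP[_ tr]].
by rewrite inE => /orP[/eqP->|/(IH tr)].
Qed.

Lemma trail_time x w e :
  trail x w -> e \in unzip1 w -> exists2 t, t \in unzip2 w & t \in times e.
Proof.
move=> tr /mapP[et in_w ->]; exists et.2; first exact: map_f.
exact: trail_times tr in_w.
Qed.

Lemma trail_head_time x w e :
  trail x w -> e \in unzip1 w -> first_time e <= (head (0, 0) w).2.
Proof.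
case: w => // et w tr /mapP[et' et'_in ->].
apply: leq_trans (first_time_le (trail_times tr et'_in)) _.
move: et'_in tr; rewrite inE => /orP[/eqP->//|et'_in] /=.
by move=> /and5P[_ _ _ _ /andP[/allP lt _]]; exact/ltnW/lt/map_f.
Qed.

Lemma trail_perm x w : trail x w -> size w = m -> perm_eq (unzip1 w) (iota 0 m).
Proof.
move=> tr sz; apply: uniq_perm (trail_uniq tr) (iota_uniq _ _) _.
have sub : {subset unzip1 w <= iota 0 m}.
  by move=> e /(trail_lt tr); rewrite mem_iota.
by have [] := uniq_min_size (trail_uniq tr) sub _; rewrite ?size_iota ?size_map ?sz.
Qed.

Lemma mem_covering_trail x w e : trail x w -> size w = m -> (e \in unzip1 w) = (e < m).
Proof. by move=> tr sz; rewrite (perm_mem (trail_perm tr sz)) mem_iota. Qed.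

(* The edges straddling [t] are used at distinct times of [[t - d, t + d]]. *)
Lemma coverage_le_trail x w n t d :
  trail x w -> size w = m -> n <= m ->
  (forall i, i < n -> last_time i - first_time i <= d) ->
  coverage n t <= d.*2.+1.
Proof.
move=> tr sz n_le span_le.
pose P i := (i < n) && straddles t i.
have -> : coverage n t = count P (iota 0 n).
  by apply: eq_in_count => i; rewrite mem_iota /P => /andP[_ ->].
have /leq_trans -> // : count P (iota 0 n) <= count P (unzip1 w).
  by rewrite (permP (trail_perm tr sz)) -(subnKC n_le) iotaD count_cat leq_addr.
rewrite count_map -size_filter -(size_map snd) -(size_iota (t - d) d.*2.+1).
apply: uniq_leq_size.
  by apply: subseq_uniq (trail_uniq_times tr); apply/map_subseq/filter_subseq.
move=> t'; rewrite mem_iota => /mapP[et + ->]; rewrite mem_filter.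
move=> /andP[/andP[/= lt /andP[first_t t_last]] /(trail_times tr) t_in].
have := first_time_le t_in; have := last_time_ge t_in; have := span_le _ lt.
by rewrite /= -addnn; lia.
Qed.

(** * The search *)

Section Search.

Hypothesis loopless : forall i, i < m -> end1 i != end2 i.
Hypothesis nonempty : forall i, i < m -> times i != [::].

Lemma odd_degree x w z : trail x w ->
  odd (count (incident^~ z) (unzip1 w)) = (z == x) (+) (z == endpoint x w).
Proof.
elim: w => [_|et w IH] /=; first by rewrite addbb.
move=> /and5P[lt _ inc _ /andP[_ tr]]; rewrite oddD IH // oddb.
have : ~~ ((z == end1 et.1) && (z == end2 et.1)).
  by apply: contra (loopless lt) => /andP[/eqP<- /eqP<-].
move: inc; rewrite /incident /opposite.
by case/orP=> /eqP->; rewrite ?addKn ?addnK;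
  case: (z == x); case: (z == end1 _); case: (z == end2 _).
Qed.

(* The end of a trail is read off the parities of the degrees. *)
Lemma endpoint_perm x w w' : trail x w -> trail x w' ->
  unzip1 w =i unzip1 w' -> endpoint x w = endpoint x w'.
Proof.
move=> tr tr' eqw; have pe : perm_eq (unzip1 w) (unzip1 w').
  by apply: uniq_perm => //; apply: trail_uniq; eassumption.
have := odd_degree (endpoint x w) tr'.
by rewrite -(permP pe) (odd_degree _ tr) eqxx => /addbI/esym/eqP.
Qed.

Variable starts : seq nat.

(* A search record [(j, w)] is a trail [w] from the [j]-th candidate start. *)
Definition origin (r : search_record) := nth 0 starts r.1.

Definition closed_record (r : search_record) := origin r == endpoint (origin r) r.2.

Definition same_record (r r' : search_record) :=
  r.1 = r'.1 /\ unzip1 r.2 =i unzip1 r'.2.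

Definition complete t (w : seq (nat * nat)) :=
  all (fun e => (last_time e <= t) ==> (e \in unzip1 w)) (active m t).

Definition extends t (r : search_record) e :=
  [&& e \notin unzip1 r.2, incident e (endpoint (origin r) r.2)
    & complete t ((e, t) :: r.2)].

Definition extensions t (r : search_record) : seq search_record :=
  [seq (r.1, (e, t) :: r.2) | e <- active m t & extends t r e].

Definition successors t (r : search_record) : seq search_record :=
  (if complete t r.2 then [:: r] else [::]) ++ extensions t r.

Definition good_record t (r : search_record) :=
  [/\ r.1 < size starts, trail (origin r) r.2, all (fun t' => t' < t) (unzip2 r.2)
    & forall e, e < m -> last_time e < t -> e \in unzip1 r.2].

Lemma completeP t w :
  reflect (forall e, e < m -> last_time e = t -> e \in unzip1 w) (complete t w).
Proof.
apply: (iffP allP) => [compl e em last_t|compl e].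
  have := compl e; rewrite mem_active em -last_t last_time_in ?nonempty // leqnn.
  exact.
rewrite mem_active => /andP[em /last_time_ge t_le]; apply/implyP => le_t.
by apply: compl => //; apply/eqP; rewrite eqn_leq le_t.
Qed.

Lemma eq_complete t w w' : unzip1 w =i unzip1 w' -> complete t w = complete t w'.
Proof. by move=> eqw; apply: eq_all => e; rewrite eqw. Qed.

Lemma good_record_complete t r :
  good_record t r -> complete t r.2 -> good_record t.+1 r.
Proof.
move=> [lt tr old dead] /completeP compl; split=> // [|e em].
  by apply: sub_all old => t' /ltnW.
by rewrite ltnS leq_eqVlt => /orP[/eqP|]; [exact: compl|exact: dead].
Qed.

Lemma good_record_extends t r e : good_record t r -> e \in active m t ->
  extends t r e -> good_record t.+1 (r.1, (e, t) :: r.2).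
Proof.
move=> [lt tr old dead]; rewrite mem_active => /andP[em te].
move=> /and3P[new inc /completeP compl]; split=> //=.
- by rewrite em te inc new old.
- by rewrite ltnSn; apply: sub_all old => t' /ltnW.
- move=> e' em'; rewrite ltnS leq_eqVlt => /orP[/eqP|lt']; first exact: compl.
  by rewrite inE dead ?orbT.
Qed.

Lemma successors_good t r r' :
  good_record t r -> r' \in successors t r -> good_record t.+1 r'.
Proof.
move=> good; rewrite mem_cat => /orP[|/mapP[e]].
  by case: ifP => // compl; rewrite inE => /eqP->; exact: good_record_complete.
by rewrite mem_filter => /andP[ext act] ->; exact: good_record_extends.
Qed.

Lemma good_record_pred t r' : good_record t.+1 r' ->
  exists2 r, good_record t r & r' \in successors t r.
Proof.
case: r' => j w [/= lt tr old dead].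
have compl : complete t w.
  by apply/completeP => e em last_t; apply: dead; rewrite ?last_t.
case: (boolP (all (fun t' => t' < t) (unzip2 w))) => [older|].
  exists (j, w); last by rewrite mem_cat compl mem_head.
  by split=> // e em /ltnW; exact: dead.
case: w tr old dead compl => [|[e u] w] //= /and5P[/= em eu inc new /andP[older tr]].
move=> /andP[+ _] dead compl.
rewrite ltnS leq_eqVlt => /orP[/eqP eq_u|lt_u]; last first.
  by rewrite lt_u; case/negP; apply: sub_all older => t' /ltn_trans; exact.
subst u => _; exists (j, w); last first.
  rewrite mem_cat; apply/orP; right; apply/mapP; exists e => //.
  by rewrite mem_filter mem_active em eu !andbT; apply/and3P.
split=> // e' em' lt'; have := dead e' em' (ltnW lt'); rewrite inE.
case/orP=> // /eqP eq_e.
by have := last_time_ge eu; rewrite -eq_e leqNgt lt'.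
Qed.

Lemma eq_extends t r1 r2 e : good_record t r1 -> good_record t r2 ->
  same_record r1 r2 -> extends t r1 e = extends t r2 e.
Proof.
move=> [_ tr1 _ _] [_ tr2 _ _] [eqj eqw].
have eqo : origin r1 = origin r2 by rewrite /origin eqj.
rewrite /extends eqw (@eq_complete t _ ((e, t) :: r2.2)); last first.
  by move=> e'; rewrite /= !inE eqw.
rewrite eqo in tr1 *; by rewrite (endpoint_perm tr1 tr2).
Qed.

Lemma same_record_successors t r1 r2 r1' :
  good_record t r1 -> good_record t r2 -> same_record r1 r2 ->
  r1' \in successors t r1 -> exists2 r2', r2' \in successors t r2 & same_record r1' r2'.
Proof.
move=> good1 good2 same; have [eqj eqw] := same; rewrite mem_cat => /orP[|/mapP[e]].
  case: ifP => // compl; rewrite inE => /eqP->; exists r2 => //.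
  by rewrite mem_cat -(eq_complete _ eqw) compl mem_head.
rewrite mem_filter (eq_extends _ good1 good2 same) -mem_filter => ext ->.
exists (r2.1, (e, t) :: r2.2); last by split=> //= e'; rewrite !inE eqw.
by rewrite mem_cat; apply/orP; right; apply/mapP; exists e.
Qed.

Definition code (r : search_record) := r.1 * 2 ^ m + \sum_(e <- unzip1 r.2) 2 ^ e.

Lemma eq_codeP t t' r r' : good_record t r -> good_record t' r' ->
  code r = code r' <-> same_record r r'.
Proof.
move=> [_ tr _ _] [_ tr' _ _].
have us := trail_uniq tr; have lt_m e := @trail_lt _ _ e tr.
have us' := trail_uniq tr'; have lt_m' e := @trail_lt _ _ e tr'.
split=> [eqc|[eqj eqw]]; last first.
  by rewrite /code eqj; congr (_ + _); apply/perm_big/uniq_perm.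
have eqj : r.1 = r'.1.
  have := congr1 (divn^~ (2 ^ m)) eqc.
  by rewrite /code !divnMDl ?expn_gt0 // !divn_small ?addn0 //; exact: sum_exp2_lt.
split=> //; move: eqc; rewrite /code eqj => /addnI.
exact: (sum_exp2_inj us lt_m us' lt_m').
Qed.

Definition push (L : seq search_record) r :=
  if code r \in map code L then L else rcons L r.

Lemma mem_foldl_push L s r : r \in foldl push L s -> r \in L ++ s.
Proof.
elim: s L => [|r0 s IH] L /=; first by rewrite cats0.
move=> /IH; rewrite !mem_cat inE /push; case: ifP => _; last first.
  by rewrite mem_rcons inE -orbA orbCA.
by case/orP=> ->; rewrite ?orbT.
Qed.

Lemma code_foldl_push L s r : r \in L ++ s -> code r \in map code (foldl push L s).
Proof.
elim: s L r => [|r0 s IH] L r /=; first by rewrite cats0; exact: map_f.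
rewrite mem_cat inE orbA => /orP[r_in|rs]; last by apply: IH; rewrite mem_cat rs orbT.
suff /mapP[r1 r1_in ->] : code r \in map code (push L r0).
  by apply: IH; rewrite mem_cat r1_in.
move: r_in; rewrite /push; case: ifP => [seen|_].
  by case/orP => [/(map_f code)//|/eqP->].
by rewrite map_rcons mem_rcons inE => /orP[/(map_f code)->|/eqP->];
  rewrite ?orbT ?eqxx.
Qed.

Lemma uniq_foldl_push L s : uniq (map code L) -> uniq (map code (foldl push L s)).
Proof.
elim: s L => //= r0 s IH L uL; apply: IH; rewrite /push.
by case: ifP => // new; rewrite map_rcons rcons_uniq new.
Qed.

Definition search_step t L := foldl push [::] (flatten (map (successors t) L)).

Fixpoint search t : seq search_record :=
  if t is t'.+1 then search_step t' (search t')
  else [seq (j, [::]) | j <- iota 0 (size starts)].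

Definition search_inv t L :=
  [/\ {in L, forall r, good_record t r},
      forall r, good_record t r -> exists2 r', r' \in L & same_record r r'
    & uniq (map code L)].

Lemma search_step_inv t L : search_inv t L -> search_inv t.+1 (search_step t L).
Proof.
move=> [sound compl _].
have sound' r : r \in flatten (map (successors t) L) -> good_record t.+1 r.
  by move=> /flatten_mapP[r0 /sound]; exact: successors_good.
split=> [r|r' good'|]; last exact: uniq_foldl_push.
  by move=> /mem_foldl_push; exact: sound'.
have [r good succ] := good_record_pred good'.
have [r1 r1_in same1] := compl r good.
have [r2 r2_in same2] := same_record_successors good (sound _ r1_in) same1 succ.
have r2_succ : r2 \in flatten (map (successors t) L) by apply/flatten_mapP; exists r1.
have /mapP[r3 r3_in eqc] := code_foldl_push (L := [::]) r2_succ.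
exists r3 => //; have good3 := sound' _ (mem_foldl_push r3_in).
apply/(eq_codeP good' good3); rewrite -eqc.
exact/(eq_codeP good' (sound' _ r2_succ)).
Qed.

Lemma searchP t : search_inv t (search t).
Proof.
elim: t => [|t IH]; last exact: search_step_inv.
split=> /=.
- by move=> r /mapP[j]; rewrite mem_iota => j_lt ->; split.
- case=> j [|[e t] w] [/= j_lt tr old dead] //.
  by exists (j, [::]) => //; apply/mapP; exists j; rewrite ?mem_iota.
- rewrite -map_comp map_inj_uniq ?iota_uniq // => j j' /=.
  by rewrite /code /= !big_nil !addn0 => /eqP; rewrite eqn_pmul2r ?expn_gt0 // => /eqP.
Qed.

Lemma unused_before_first t r e :
  good_record t r -> t <= first_time e -> e \notin unzip1 r.2.
Proof.
move=> [_ tr /allP old _] le; apply/negP => /(trail_time tr)[t' /old t'_lt].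
by move=> /first_time_le; rewrite leqNgt (leq_trans t'_lt).
Qed.

Lemma same_record_straddles t r r' : good_record t r -> good_record t r' ->
  r.1 = r'.1 ->
  {in [seq e <- iota 0 m | straddles t e], unzip1 r.2 =i unzip1 r'.2} ->
  same_record r r'.
Proof.
move=> good good' eqj eq_str; split=> // e.
have [_ tr _ dead] := good; have [_ tr' _ dead'] := good'.
case: (ltnP e m) => [em|ge]; last first.
  by apply/idP/idP => [/(trail_lt tr)|/(trail_lt tr')]; rewrite ltnNge ge.
case: (ltnP (last_time e) t) => [lt|t_last]; first by rewrite dead ?dead'.
case: (leqP (first_time e) t) => [first_t|/ltnW gt].
  by apply: eq_str; rewrite mem_filter /straddles first_t t_last mem_iota.
by rewrite !(negbTE (unused_before_first _ gt)).
Qed.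

Lemma size_search_le t : size (search t) <= size starts * 2 ^ coverage m t.
Proof.
have [sound _ uniq_codes] := searchP t.
pose straddling := [seq e <- iota 0 m | straddles t e].
pose trace (r : search_record) := (r.1, [seq e \in unzip1 r.2 | e <- straddling]).
pose traces := [seq (j, val b) | j <- iota 0 (size starts),
                                 b <- enum {: (size straddling).-tuple bool}].
have -> : size starts * 2 ^ coverage m t = size traces.
  by rewrite size_allpairs size_iota -cardE card_tuple card_bool size_filter.
rewrite -(size_map trace (search t)); apply: uniq_leq_size.
  rewrite map_inj_in_uniq ?(map_uniq uniq_codes) //.
  move=> r r' r_in r'_in [eqj /eq_in_map eq_str].
  have good := sound _ r_in; have good' := sound _ r'_in.
  apply: (uniq_map_inj uniq_codes r_in r'_in); apply/(eq_codeP good good').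
  exact: same_record_straddles good good' eqj eq_str.
move=> _ /mapP[r /sound[lt _ _ _] ->].
have sz : size [seq e \in unzip1 r.2 | e <- straddling] == size straddling.
  by rewrite size_map.
apply/allpairsP; exists (r.1, Tuple sz); split=> //; first by rewrite mem_iota.
by rewrite mem_enum.
Qed.

Lemma good_record_horizon r : r.1 < size starts ->
  good_record (horizon m) r <-> trail (origin r) r.2 /\ size r.2 = m.
Proof.
move=> lt; split=> [[_ tr _ dead]|[tr sz]].
  split=> //; apply/eqP; rewrite -(size_map fst) -(size_iota 0 m) eqn_leq.
  rewrite !uniq_leq_size ?iota_uniq ?(trail_uniq tr) //.
    by move=> e; rewrite mem_iota => /= em; apply: dead => //; exact: lt_horizon.
  by move=> e /(trail_lt tr); rewrite mem_iota.
split=> // [|e em _]; last by rewrite (mem_covering_trail _ tr sz).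
apply/allP => _ /mapP[et et_in ->].
apply: leq_ltn_trans (last_time_ge (trail_times tr et_in)) (lt_horizon _).
by apply: trail_lt tr _; exact: map_f.
Qed.

End Search.

(** * Candidate starts *)

Definition min_last n := \big[minn/last_time 0]_(i <- iota 0 n) last_time i.

Definition candidates M n :=
  flatten [seq [:: end1 i; end2 i] | i <- iota 0 n & first_time i <= M].

Lemma candidatesS M n : candidates M n.+1 =
  candidates M n ++ (if first_time n <= M then [:: end1 n; end2 n] else [::]).
Proof.
rewrite /candidates iota_rcons filter_rcons; case: ifP => _; last by rewrite cats0.
by rewrite map_rcons flatten_rcons.
Qed.

Lemma min_last_le n i : i < n -> min_last n <= last_time i.
Proof.
move=> lt; rewrite /min_last -minEnat.
by apply: (Order.TotalTheory.ge_bigmin_seq (T := nat) _ i xpredT); rewrite ?mem_iota.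
Qed.

Lemma le_min_last n M :
  0 < n -> (forall i, i < n -> M <= last_time i) -> M <= min_last n.
Proof.
move=> n0 le_last; rewrite /min_last big_seq.
apply: (big_ind (leq M)) => [|x y Mx My|i]; first exact: le_last.
  by rewrite leq_min Mx.
by rewrite mem_iota => /le_last.
Qed.

Lemma mem_candidates M n e x :
  e < n -> first_time e <= M -> incident e x -> x \in candidates M n.
Proof.
move=> lt first_M inc; apply/flatten_mapP; exists e; last by rewrite !inE.
by rewrite mem_filter first_M mem_iota.
Qed.

Lemma size_candidates n :
  size (candidates (min_last n) n) <= (coverage n (min_last n)).*2.
Proof.
rewrite /candidates /coverage size_flatten /shape -map_comp.
rewrite sumnE big_map /= big_const_seq count_predT iter_addn_0 mul2n leq_double.
rewrite size_filter (eq_in_count (a2 := straddles (min_last n))) // => i.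
by rewrite mem_iota /straddles => /andP[_ /min_last_le->]; rewrite andbT.
Qed.

Lemma trail_first_le x w e t : trail x (rcons w (e, t)) ->
  [/\ e < m, incident e x & {in rcons w (e, t), forall et, first_time e <= et.2}].
Proof.
elim: w => [|et w IH] /=.
  move=> /and4P[em te inc _]; split=> // et; rewrite inE => /eqP->.
  exact: first_time_le.
move=> /and5P[_ _ _ _ /andP[/allP older /IH[em inc first_le]]]; split=> // et'.
rewrite inE => /orP[/eqP->|]; last exact: first_le.
have e_in : (e, t) \in rcons w (e, t) by rewrite mem_rcons mem_head.
exact: leq_trans (first_le _ e_in) (ltnW (older _ (map_f snd e_in))).
Qed.

(* The first edge of an Eulerian trail starts no later than any edge ends. *)
Lemma eulerian_trail_start x w :
  0 < m -> eulerian_trail x w -> x \in candidates (min_last m) m.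
Proof.
move=> m0 [tr sz _].
case/lastP: w tr sz => [_ sz|w [e t] tr sz]; first by rewrite -sz in m0.
have [em inc first_le] := trail_first_le tr.
apply: mem_candidates em _ inc; apply: le_min_last => // i im.
have /mapP[et et_in ->] : i \in unzip1 (rcons w (e, t)).
  by rewrite (mem_covering_trail _ tr sz).
exact: leq_trans (first_le _ et_in) (last_time_ge (trail_times tr et_in)).
Qed.

Lemma search_correct :
  0 < m -> (forall i, i < m -> end1 i != end2 i) ->
  (forall i, i < m -> times i != [::]) ->
  let starts := candidates (min_last m) m in
  (exists x w, eulerian_trail x w) <->
  exists2 r, r \in search starts (horizon m) & closed_record starts r.
Proof.
move=> m0 loopless nonempty starts.
have [sound compl _] := searchP loopless nonempty starts (horizon m).
split=> [[x [w euler]]|[r /sound good /eqP closed_r]]; last first.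
  exists (origin starts r), r.2; have [lt _ _ _] := good.
  by have [tr sz] := (good_record_horizon lt).1 good; split.
have x_in := eulerian_trail_start m0 euler; have [tr sz closed_w] := euler.
pose r := (index x starts, w).
have origin_r : origin starts r = x by rewrite /origin nth_index.
have good : good_record starts (horizon m) r.
  by apply/good_record_horizon; rewrite ?index_mem ?origin_r.
have [r' r'_in [eqj eqw]] := compl _ good; exists r' => //.
have origin_r' : origin starts r' = x by rewrite -origin_r /origin eqj.
have [_ tr' _ _] := sound _ r'_in; rewrite /closed_record origin_r' in tr' *.
by rewrite -{1}closed_w (endpoint_perm loopless tr tr' eqw).
Qed.

End Instance.

(** * From temporal graphs to numbered instances *)

Lemma span_le_gaps (s : seq nat) u :
  (forall x y, x \in s -> y \in s -> x < y ->
     (forall z, z \in s -> ~~ (x < z < y)) -> y - x <= u) ->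
  forall x y, x \in s -> y \in s -> y - x <= count (fun z => x < z <= y) s * u.
Proof.
move=> gap x y; have [n] := ubnP (y - x); elim: n x => // n IH x lt_n xs ys.
case: (leqP y x) => [|xy]; first by rewrite -subn_eq0 => /eqP->.
have ex : exists z, (z \in s) && (x < z) by exists y; rewrite ys.
have [z /andP[zs xz] zmin] := ex_minnP ex.
have zy : z <= y by apply: zmin; rewrite ys.
have gap_xz : z - x <= u.
  apply: gap => // v vs; apply/negP => /andP[xv].
  by rewrite ltnNge zmin ?vs.
have count_lt : count (fun v => z < v <= y) s < count (fun v => x < v <= y) s.
  rewrite -add1n; apply: (@leq_trans (count (predU (pred1 z) (fun v => z < v <= y)) s)).
    have disj : count (predI (pred1 z) (fun v => z < v <= y)) s = 0.
      by apply/eqP; rewrite eqn0Ngt -has_count; apply/hasPn => v _ /=;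
        case: eqP => // ->; rewrite ltnn.
    have := count_predUI (pred1 z) (fun v => z < v <= y) s; rewrite disj addn0 => ->.
    by rewrite leq_add2r -has_count has_pred1.
  apply: sub_count => v /= /orP[/eqP->|/andP[zv ->]]; first by rewrite xz.
  by rewrite (ltn_trans xz).
have IHz : y - z <= count (fun v => z < v <= y) s * u by apply: IH => //; lia.
apply: (@leq_trans ((count (fun v => z < v <= y) s).+1 * u)).
  by rewrite mulSn; lia.
by rewrite leq_mul2r count_lt orbT.
Qed.

Section Encoding.

Variables (V : finType) (G : temporal_graph V).
Variables (num : V -> nat) (rs : seq (V * V * seq nat)).

Local Notation edge_sets := [seq [set r.1.1; r.1.2] | r <- rs].

Hypothesis num_inj : injective num.
Hypothesis rs_edges : perm_eq edge_sets (enum (tg_edges G)).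
Hypothesis rs_times :
  forall r, r \in rs -> perm_eq r.2 (tg_times G [set r.1.1; r.1.2]).

Definition numbered : seq (nat * nat * seq nat) :=
  [seq (num r.1.1, num r.1.2, r.2) | r <- rs].

Local Notation es := numbered.
Local Notation m := (size es).

Definition edge_set i := nth set0 edge_sets i.

Lemma size_numbered : m = size edge_sets.
Proof. by rewrite !size_map. Qed.

Lemma edge_sets_uniq : uniq edge_sets.
Proof. by rewrite (perm_uniq rs_edges) enum_uniq. Qed.

Lemma mem_edge_sets e : (e \in edge_sets) = (e \in tg_edges G).
Proof. by rewrite (perm_mem rs_edges) mem_enum. Qed.

Lemma edge_set_in i : i < m -> edge_set i \in tg_edges G.
Proof. by rewrite -mem_edge_sets size_numbered; exact: mem_nth. Qed.

Lemma edge_set_index e : e \in tg_edges G -> edge_set (index e edge_sets) = e.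
Proof. by rewrite -mem_edge_sets; exact: nth_index. Qed.

Lemma index_edge_lt e : e \in tg_edges G -> index e edge_sets < m.
Proof. by rewrite -mem_edge_sets size_numbered index_mem. Qed.

Lemma edge_set_ends i : i < m ->
  exists a b, [/\ edge_set i = [set a; b], end1 es i = num a, end2 es i = num b
    & a != b].
Proof.
move=> im; have := tg_simple (edge_set_in im); move: im.
rewrite size_map /edge_set /end1 /end2 /edge /numbered.
case: rs => // r0 rs' im; rewrite !(nth_map r0) // cards2 => card_e.
set r := nth r0 _ i in card_e *.
by exists r.1.1, r.1.2; split=> //; case: eqP card_e.
Qed.

Lemma times_edge_set i : i < m -> perm_eq (times es i) (tg_times G (edge_set i)).
Proof.
rewrite size_map /edge_set /times /edge /numbered.
case: rs rs_times => // r0 rs' timesP im; rewrite !(nth_map r0) //.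
by apply: timesP; exact: mem_nth.
Qed.

Lemma numbered_loopless i : i < m -> end1 es i != end2 es i.
Proof.
move=> /edge_set_ends[a [b [_ -> -> ab]]].
by rewrite (inj_eq num_inj).
Qed.

Lemma numbered_times_uniq i : i < m -> uniq (times es i).
Proof. by move=> /times_edge_set/perm_uniq->; exact: fset_uniq. Qed.

Lemma set2_inj (a b x y : V) : a != b -> [set a; b] = [set x; y] ->
  (a = x /\ b = y) \/ (a = y /\ b = x).
Proof.
move=> ab eq_ab.
have : a \in [set x; y] by rewrite -eq_ab set21.
have : b \in [set x; y] by rewrite -eq_ab set22.
rewrite !inE => /orP[]/eqP bE /orP[]/eqP aE; [|by right|by left|];
  by rewrite aE bE eqxx in ab.
Qed.

Lemma edge_set_opposite i x y : i < m -> edge_set i = [set x; y] ->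
  incident es i (num x) /\ opposite es i (num x) = num y.
Proof.
move=> /edge_set_ends[a [b [-> Ea Eb ab]]] /(set2_inj ab).
rewrite /incident /opposite Ea Eb.
by case=> -[-> ->]; rewrite eqxx ?orbT ?addKn ?addnK.
Qed.

Lemma incident_edge_set i x : i < m -> incident es i (num x) ->
  exists y, edge_set i = [set x; y].
Proof.
move=> /edge_set_ends[a [b [-> Ea Eb _]]]; rewrite /incident Ea Eb.
by case/orP=> /eqP/num_inj->; [exists b|exists a; rewrite setUC].
Qed.

Lemma walk_rcons x s e y :
  walk G x (rcons s e) y <->
  exists z, [/\ walk G x s z, e \in tg_edges G & e = [set z; y]].
Proof.
elim: s x => [|e1 s IH] x /=; split.
- by case=> eE [z ez <-]; exists x.
- by case=> z [<- eE ez]; split=> //; exists y.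
- by case=> e1E [z ez /IH[z' [w eE e']]]; exists z'; split=> //; split=> //; exists z.
- by case=> z [[e1E [z1 e1z w]] eE ez]; split=> //; exists z1 => //; apply/IH; exists z.
Qed.

Lemma walk_edges x s y e : walk G x s y -> e \in s -> e \in tg_edges G.
Proof.
elim: s x => //= e1 s IH x [e1E [z _ w]]; rewrite inE => /orP[/eqP->//|].
exact: IH w.
Qed.

Lemma temporal_walk_rcons x y w e t :
  temporal_walk G x y (rcons w (e, t)) <->
  exists z, [/\ temporal_walk G x z w, e \in tg_edges G, e = [set z; y],
                t \in tg_times G e & all (fun t' => t' < t) (unzip2 w)].
Proof.
rewrite /temporal_walk /unzip1 /unzip2 !map_rcons !(sorted_pairwise ltn_trans).
rewrite pairwise_rcons; split.
  case=> /walk_rcons[z [wk eE ez]] times_w /andP[lt_t st]; exists z; split=> //.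
    split=> // et et_in; apply: times_w; by rewrite mem_rcons inE et_in orbT.
  by apply: (times_w (e, t)); rewrite mem_rcons mem_head.
case=> z [[wk times_w st] eE ez te lt_t]; split; last by rewrite st andbT.
  by apply/walk_rcons; exists z.
by move=> et; rewrite mem_rcons inE => /orP[/eqP->|/times_w].
Qed.

Definition trail_of_walk (w : seq ({set V} * nat)) :=
  rev [seq (index et.1 edge_sets, et.2) | et <- w].

Definition walk_of_trail (w : seq (nat * nat)) :=
  rev [seq (edge_set et.1, et.2) | et <- w].

Lemma trail_of_walkP x y w : temporal_walk G x y w -> uniq (unzip1 w) ->
  trail es (num x) (trail_of_walk w) /\ endpoint es (num x) (trail_of_walk w) = num y.
Proof.
elim/last_ind: w y => [|w [e t] IH] y; first by case=> /= ->.
move=> /temporal_walk_rcons[z [tw eE ez te lt_t]].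
rewrite /unzip1 map_rcons rcons_uniq => /andP[/= new /(IH _ tw)[tr ends]].
have em := index_edge_lt eE.
have [inc opp] := edge_set_opposite em (etrans (edge_set_index eE) ez).
rewrite /trail_of_walk map_rcons rev_rcons /= -/(trail_of_walk w) ends opp; split=> //.
rewrite em (perm_mem (times_edge_set em)) edge_set_index // te inc tr andbT /=.
apply/andP; split; last first.
  by rewrite /unzip2 /trail_of_walk map_rev all_rev -map_comp.
rewrite /unzip1 /trail_of_walk map_rev mem_rev -map_comp.
apply/mapP => -[et et_in /= eq_i].
have [wk _ _] := tw; have eE' := walk_edges wk (map_f fst et_in).
by case/negP: new; rewrite -(edge_set_index eE) eq_i edge_set_index // map_f.
Qed.

Lemma walk_of_trailP x w : trail es (num x) w ->
  exists2 y, temporal_walk G x y (walk_of_trail w) & endpoint es (num x) w = num y.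
Proof.
elim: w => [|[e t] w IH] /=; first by exists x.
move=> /and5P[em te inc _ /andP[older /IH[z tw ends]]]; rewrite ends in inc *.
have [y edge_zy] := incident_edge_set em inc.
exists y; last by have [] := edge_set_opposite em edge_zy.
rewrite /walk_of_trail /= rev_cons; apply/temporal_walk_rcons; exists z; split=> //.
- exact: edge_set_in.
- by rewrite -(perm_mem (times_edge_set em)).
- by rewrite /unzip2 map_rev all_rev -map_comp.
Qed.

Lemma trail_start_num x w : trail es x w -> w != [::] -> exists X, x = num X.
Proof.
elim: w => //= et [|et' w] IH /and5P[em _ inc _ /andP[_ tr]] _; last exact: IH.
have [a [b [_ Ea Eb _]]] := edge_set_ends em.
by move: inc; rewrite /incident /= Ea Eb => /orP[]/eqP->; [exists a|exists b].
Qed.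

Lemma temporal_circuit_trail w : temporal_euler_circuit G w ->
  exists x, eulerian_trail es x (trail_of_walk w).
Proof.
case=> [[x tw] [_ once]]; have [wk _ _] := tw.
have perm_w : perm_eq (unzip1 w) edge_sets.
  apply/allP => e; rewrite mem_cat /= => e_in.
  have eE : e \in tg_edges G.
    by case/orP: e_in => [/(walk_edges wk)|]; rewrite ?mem_edge_sets.
  by rewrite once // count_uniq_mem ?edge_sets_uniq // mem_edge_sets eE.
have uniq_w : uniq (unzip1 w) by rewrite (perm_uniq perm_w) edge_sets_uniq.
have [tr ends] := trail_of_walkP tw uniq_w.
exists (num x); split=> //.
by rewrite size_numbered -(perm_size perm_w) /trail_of_walk size_rev !size_map.
Qed.

Lemma trail_temporal_circuit x w : 0 < m -> eulerian_trail es x w ->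
  temporal_euler_circuit G (walk_of_trail w).
Proof.
move=> m0 [tr sz closed].
have [X eq_x] : exists X, x = num X.
  by apply: trail_start_num tr _; rewrite -size_eq0 sz -lt0n.
subst x; have [y tw] := walk_of_trailP tr; rewrite closed => /num_inj eq_y; subst y.
split; first by exists X.
split; first by exists X; case: tw.
move=> e eE; rewrite /unzip1 /walk_of_trail map_rev count_rev -map_comp.
rewrite -[map _ _]/(map (edge_set \o fst) w) map_comp.
rewrite (permP (perm_map edge_set (trail_perm tr sz))) size_numbered.
by rewrite -/(mkseq _ _) mkseq_nth count_uniq_mem ?edge_sets_uniq // mem_edge_sets eE.
Qed.

Lemma temporally_eulerianE : 0 < m ->
  temporally_eulerian G <-> exists x w, eulerian_trail es x w.
Proof.
move=> m0; split=> [[w /temporal_circuit_trail[x euler]]|[x [w euler]]].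
  by exists x, (trail_of_walk w).
by exists (walk_of_trail w); exact: trail_temporal_circuit euler.
Qed.

Lemma temporally_eulerian_no_edge :
  m = 0 -> temporally_eulerian G <-> 0 < #|V|.
Proof.
move=> m0; have no_edge e : e \in tg_edges G = false.
  by apply/negP => /index_edge_lt; rewrite m0.
split=> [[w [[x _] _]]|/card_gt0P[x _]]; first by apply/card_gt0P; exists x.
by exists [::]; split; [exists x|split=> [|e]; [exists x|rewrite no_edge]].
Qed.

Lemma numbered_span_le k u i :
  temp_euler_instance G k -> consecutive_gaps_at_most G u -> i < m ->
  last_time es i - first_time es i <= k * u.
Proof.
move=> few_times small_gaps im; have eE := edge_set_in im.
case: (eqVneq (times es i) [::]) => [t0|ne].
  by rewrite /last_time t0 big_nil.
have in_times t := perm_mem (times_edge_set im) t.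
apply: leq_trans (span_le_gaps _ (first_time_in ne) (last_time_in ne)) _ => [x y|].
  rewrite !in_times => xT yT xy no_between; apply: small_gaps eE _ _ _; split=> // z zT.
  by apply: no_between; rewrite in_times.
rewrite leq_mul2r (leq_trans (count_size _ _)) ?orbT //.
by rewrite (perm_size (times_edge_set im)) few_times.
Qed.

Lemma last_time_le_lifetime i : i < m -> last_time es i <= lifetime G.
Proof.
move=> im; case: (eqVneq (times es i) [::]) => [t0|/last_time_in].
  by rewrite /last_time t0 big_nil.
rewrite (perm_mem (times_edge_set im)) => last_in.
apply: leq_trans (leq_bigmax_cond (edge_set i) (edge_set_in im)).
by rewrite (leq_bigmax_seq _ last_in).
Qed.

End Encoding.

(** * The program *)

Local Notation "p ;; q" := (Seq p q) (at level 60, right associativity).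

Local Notation rResult := 0 (only parsing).
Local Notation rEdges := 1 (only parsing).
Local Notation rCur := 2 (only parsing).
Local Notation rPos := 3 (only parsing).
Local Notation rLeft := 4 (only parsing).
Local Notation rFirst := 5 (only parsing).
Local Notation rLast := 6 (only parsing).
Local Notation rSpan := 7 (only parsing).
Local Notation rHorizon := 8 (only parsing).
Local Notation rWeight := 9 (only parsing).
Local Notation rBad := 10 (only parsing).
Local Notation rNow := 11 (only parsing).
Local Notation rTime := 12 (only parsing).
Local Notation rMinLast := 13 (only parsing).
Local Notation rBase := 14 (only parsing).
Local Notation rLo := 15 (only parsing).
Local Notation rHi := 16 (only parsing).
Local Notation rTop := 17 (only parsing).
Local Notation rMissing := 18 (only parsing).
Local Notation rPtr := 19 (only parsing).
Local Notation rEdge := 20 (only parsing).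
Local Notation rAncestor := 21 (only parsing).
Local Notation rFound := 22 (only parsing).
Local Notation rNewCode := 23 (only parsing).
Local Notation rNewVertex := 24 (only parsing).
Local Notation rNewStamp := 25 (only parsing).
Local Notation rNewVia := 26 (only parsing).
Local Notation rNewParent := 27 (only parsing).

Local Notation aInput := 0 (only parsing).
Local Notation aEnd1 := 1 (only parsing).
Local Notation aEnd2 := 2 (only parsing).
Local Notation aFirst := 3 (only parsing).
Local Notation aLast := 4 (only parsing).
Local Notation aWeight := 5 (only parsing).
Local Notation aCover := 6 (only parsing).
(* The edges active at a time [t] form a linked list from [aHead]; its pointers
   are the positions in the input at which [t] is listed. *)
Local Notation aHead := 7 (only parsing).
Local Notation aNext := 8 (only parsing).
Local Notation aEdge := 9 (only parsing).
Local Notation aOrigin := 10 (only parsing).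
Local Notation aVertex := 11 (only parsing).
Local Notation aCode := 12 (only parsing).
(* The stamp of a record is the time of its last edge plus one, and zero for the
   empty trail. *)
Local Notation aStamp := 13 (only parsing).
Local Notation aVia := 14 (only parsing).
Local Notation aParent := 15 (only parsing).
(* [aSeen] maps the code of a record to the last time of its creation plus one. *)
Local Notation aSeen := 16 (only parsing).

Local Notation edge_arrays := [:: aEnd1; aEnd2; aFirst; aLast; aWeight] (only parsing).
Local Notation list_arrays := [:: aHead; aNext; aEdge] (only parsing).
Local Notation graph_arrays := (edge_arrays ++ list_arrays) (only parsing).
Local Notation record_arrays :=
  [:: aOrigin; aVertex; aCode; aStamp; aVia; aParent] (only parsing).

(* Nonzero exactly when the two values differ. *)
Definition Diff (a b : expr) : expr := Add (Sub a b) (Sub b a).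

(* Also a conjunction: nonzero exactly when both values are. *)
Definition Min (a b : expr) : expr := Sub a (Sub a b).

Definition Max (a b : expr) : expr := Add a (Sub b a).

Definition Incr x := Assign x (Add (Reg x) (Const 1)).

Definition find_step :=
  If (Diff (Read aVia (Reg rAncestor)) (Reg rEdge)) Skip (Assign rFound (Const 1)) ;;
  Assign rAncestor (Read aParent (Reg rAncestor)).

(* Stops at the ancestors that are older than the first time of [rEdge]. *)
Definition find :=
  (Assign rAncestor (Reg rLo) ;; Assign rFound (Const 0)) ;;
  While (Sub (Read aStamp (Reg rAncestor)) (Read aFirst (Reg rEdge))) find_step.

Definition lookup := Assign rEdge (Read aEdge (Reg rPtr)) ;; find.

Definition advance := Assign rPtr (Read aNext (Reg rPtr)).

Definition missing_step :=
  lookup ;;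
  (If (Add (Reg rFound) (Sub (Read aLast (Reg rEdge)) (Reg rNow)))
     Skip (Incr rMissing) ;;
   advance).

Definition count_missing :=
  (Assign rMissing (Const 0) ;; Assign rPtr (Read aHead (Reg rNow))) ;;
  While (Reg rPtr) missing_step.

Definition append_record :=
  Write aSeen (Reg rNewCode) (Add (Reg rNow) (Const 1)) ;;
  Write aOrigin (Reg rTop) (Read aOrigin (Reg rLo)) ;;
  Write aVertex (Reg rTop) (Reg rNewVertex) ;;
  Write aCode (Reg rTop) (Reg rNewCode) ;;
  Write aStamp (Reg rTop) (Reg rNewStamp) ;;
  Write aVia (Reg rTop) (Reg rNewVia) ;;
  Write aParent (Reg rTop) (Reg rNewParent) ;;
  Incr rTop.

Definition push_record :=
  If (Diff (Read aSeen (Reg rNewCode)) (Add (Reg rNow) (Const 1))) append_record Skip.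

Definition copy_record :=
  Assign rNewCode (Read aCode (Reg rLo)) ;;
  Assign rNewVertex (Read aVertex (Reg rLo)) ;;
  Assign rNewStamp (Read aStamp (Reg rLo)) ;;
  Assign rNewVia (Read aVia (Reg rLo)) ;;
  Assign rNewParent (Read aParent (Reg rLo)).

Definition keep := If (Reg rMissing) Skip (copy_record ;; push_record).

Definition extend_record :=
  Assign rNewCode (Add (Read aCode (Reg rLo)) (Read aWeight (Reg rEdge))) ;;
  Assign rNewVertex (Sub (Add (Read aEnd1 (Reg rEdge)) (Read aEnd2 (Reg rEdge)))
                         (Read aVertex (Reg rLo))) ;;
  Assign rNewStamp (Add (Reg rNow) (Const 1)) ;;
  Assign rNewVia (Reg rEdge) ;;
  Assign rNewParent (Reg rLo).

Definition cannot_extend :=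
  Add (Reg rFound)
    (Add (Min (Diff (Read aVertex (Reg rLo)) (Read aEnd1 (Reg rEdge)))
              (Diff (Read aVertex (Reg rLo)) (Read aEnd2 (Reg rEdge))))
         (Sub (Reg rMissing)
              (Sub (Const 1) (Sub (Read aLast (Reg rEdge)) (Reg rNow))))).

Definition extend_step :=
  lookup ;; (If cannot_extend Skip (extend_record ;; push_record) ;; advance).

Definition extend :=
  Assign rPtr (Read aHead (Reg rNow)) ;; While (Reg rPtr) extend_step.

Definition process_record := count_missing ;; keep ;; extend ;; Incr rLo.

Definition next_time := Assign rHi (Reg rTop) ;; Incr rNow.

Definition time_step := While (Sub (Reg rHi) (Reg rLo)) process_record ;; next_time.

Definition sweep :=
  (Assign rLo (Const 0) ;; Assign rHi (Reg rTop) ;; Assign rNow (Const 0)) ;;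
  While (Sub (Reg rHorizon) (Reg rNow)) time_step.

Definition accept :=
  While (Sub (Reg rTop) (Reg rLo))
    (If (Diff (Read aOrigin (Reg rLo)) (Read aVertex (Reg rLo)))
       Skip (Assign rResult (Const 1)) ;;
     Incr rLo).

Lemma diff_eq0 a b : (a - b + (b - a) == 0) = (a == b).
Proof. by rewrite addn_eq0 !subn_eq0 eqn_leq. Qed.

(** * Stored records *)

Definition same_cells (bs : seq nat) n s s' :=
  forall a i, a \in bs -> i < n -> arr s' a i = arr s a i.

Lemma same_cells_weaken bs n bs' n' s s' :
  all (mem bs) bs' -> n' <= n -> same_cells bs n s s' -> same_cells bs' n' s s'.
Proof.
by move=> /allP sub_bs le same a i /sub_bs a_in lt; apply: same a_in (leq_trans lt le).
Qed.

Lemma eq_arr_same_cells bs n s s' :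
  {in bs, forall a, arr s' a =1 arr s a} -> same_cells bs n s s'.
Proof. by move=> eq_arr a i a_in _; exact: eq_arr. Qed.

Fixpoint bucket s h (l : seq nat) : Prop :=
  if l is e :: l' then
    [/\ 0 < h, arr s aEdge h = e, arr s aNext h < h & bucket s (arr s aNext h) l']
  else h = 0.

Lemma eq_bucket s s' h l :
  same_cells [:: aNext; aEdge] h.+1 s s' -> bucket s h l -> bucket s' h l.
Proof.
elim: l h => [|e l IH] h same //= [h0 <- lt bk]; rewrite !same //; split=> //.
by apply: IH bk; apply: same_cells_weaken same; last exact: leqW.
Qed.

Fixpoint chain s q (w : seq (nat * nat)) : Prop :=
  if w is et :: w' then
    [/\ arr s aStamp q = et.2.+1, arr s aVia q = et.1, arr s aParent q < q
      & chain s (arr s aParent q) w']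
  else arr s aStamp q = 0.

Lemma eq_chain s s' q w :
  same_cells [:: aStamp; aVia; aParent] q.+1 s s' -> chain s q w -> chain s' q w.
Proof.
elim: w q => [|et w IH] q same /=; rewrite !same //.
case=> -> -> lt ch; split=> //; apply: IH ch.
by apply: same_cells_weaken same; last exact: leqW.
Qed.

Section Sweep.

Variable es : seq (nat * nat * seq nat).
Variable starts : seq nat.
Variable D : nat.

Local Notation m := (size es).
Local Notation origin := (origin starts).
Local Notation code := (code es).
Local Notation push := (push es).
Local Notation closed_record := (closed_record es starts).

Definition edge_loaded i s :=
  [/\ arr s aEnd1 i = end1 es i, arr s aEnd2 i = end2 es i,
      arr s aFirst i = first_time es i, arr s aLast i = last_time es i
    & arr s aWeight i = 2 ^ i].

Definition edges_upto n s := forall i, i < n -> edge_loaded i s.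

Lemma edges_upto_supported n : supported [::] edge_arrays (edges_upto n).
Proof.
move=> s s' _ eq_arr edges i lt.
by have [? ? ? ? ?] := edges i lt; split; rewrite eq_arr.
Qed.

Definition loaded s :=
  edges_upto m s /\ forall t, bucket s (arr s aHead t) (active es m t).

Lemma loaded_supported : supported [::] graph_arrays loaded.
Proof.
move=> s s' eq_reg eq_arr [edges lists]; split=> [|t].
  exact: supported_weaken (@edges_upto_supported m) _ _ eq_reg eq_arr edges.
rewrite eq_arr //; apply: eq_bucket (lists t).
exact: same_cells_weaken (eq_arr_same_cells eq_arr).
Qed.

Definition record_at s q (r : search_record) :=
  [/\ arr s aOrigin q = origin r, arr s aVertex q = endpoint es (origin r) r.2,
      arr s aCode q = code r & chain s q r.2].

Lemma eq_record_at s s' q r :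
  same_cells record_arrays q.+1 s s' -> record_at s q r -> record_at s' q r.
Proof.
move=> same [? ? ? ch]; split; rewrite ?same //.
by apply: eq_chain ch; apply: same_cells_weaken same.
Qed.

(* All the records created so far, not only those of the current time: the
   ancestors of a record stay in memory. *)
Definition stored (R : seq search_record) s :=
  reg s rTop = size R /\
  forall q, q < size R -> record_at s q (nth (0, [::]) R q).

Lemma stored_supported R : supported [:: rTop] record_arrays (stored R).
Proof.
move=> s s' eq_reg eq_arr [top recs]; split=> [|q lt]; first by rewrite eq_reg.
by apply: eq_record_at (recs q lt); exact: eq_arr_same_cells.
Qed.

Lemma stored_onth R s q r : stored R s -> onth R q = Some r -> record_at s q r.
Proof.
move=> [_ recs] Rq; have := recs q; rewrite (onth_nth _ _ _ _ Rq); apply.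
by rewrite -onthTE Rq.
Qed.

(* [acc] lists the records created at time [t]. *)
Definition marked t (acc : seq search_record) s := forall c,
  arr s aSeen c <= t.+1 /\ (arr s aSeen c == t.+1) = (c \in map code acc).

Lemma marked_supported t acc : supported [::] [:: aSeen] (marked t acc).
Proof. by move=> s s' _ eq_arr mk c; rewrite eq_arr. Qed.

Definition searching t base acc s :=
  [/\ loaded s, reg s rNow = t, stored (base ++ acc) s & marked t acc s].

Lemma searching_supported t base acc :
  supported [:: rNow; rTop] (graph_arrays ++ record_arrays ++ [:: aSeen])
    (searching t base acc).
Proof.
move=> s s' eq_reg eq_arr [ld nw st mk]; split.
- exact: supported_weaken @loaded_supported _ _ eq_reg eq_arr ld.
- by rewrite eq_reg.
- exact: supported_weaken (@stored_supported _) _ _ eq_reg eq_arr st.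
- exact: supported_weaken (@marked_supported _ _) _ _ eq_reg eq_arr mk.
Qed.

(** * Searching the ancestors of a record *)

Lemma chain_stamp_le s q w t :
  chain s q w -> all (fun t' => t' < t) (unzip2 w) -> arr s aStamp q <= t.
Proof. by case: w => [|et w] /=; [move=> ->|case=> -> _ _ _ /andP[]]. Qed.

Lemma find_stepE s : let s' := run_loop_free find_step s in
  reg s' rAncestor = arr s aParent (reg s rAncestor) /\
  reg s' rFound =
    if arr s aVia (reg s rAncestor) == reg s rEdge then 1 else reg s rFound.
Proof. by rewrite /= diff_eq0; case: ifP. Qed.

Lemma runs_find s x w e n :
  arr s aFirst e = first_time es e -> reg s rEdge = e -> trail es x w ->
  chain s (reg s rLo) w -> arr s aStamp (reg s rLo) - first_time es e <= n ->
  runs find s (22 * n + 10) (fun s' => reg s' rFound = (e \in unzip1 w)).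
Proof.
move=> first_e edge_e tr ch len.
apply: (runs_seq_loop_free (T2 := n * 22 + 6)) => // [s1 fr1 eq1|];
  last by rewrite /=; lia.
pose I k s2 := exists w',
  [/\ chain s (reg s2 rAncestor) w', trail es x w',
      (e \in unzip1 w) = (reg s2 rFound != 0) || (e \in unzip1 w'), reg s2 rFound <= 1
    & arr s aStamp (reg s2 rAncestor) - first_time es e <= k].
have cond s2 : framed find_step s1 s2 ->
    eval s2 (Sub (Read aStamp (Reg rAncestor)) (Read aFirst (Reg rEdge))) =
    arr s aStamp (reg s2 rAncestor) - first_time es e.
  move=> fr2; rewrite /= (framed_reg fr2 rEdge) // (framed_reg fr1 rEdge) // edge_e.
  by rewrite !(framed_arr fr2) // !(framed_arr fr1) // first_e.
apply: (runs_while (I := I) (C := 16) (n := n)).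
- by exists w; rewrite eq1.
- move=> k s2 fr2 [w' [ch' tr' eqw found1 len']]; rewrite cond //.
  case: w' ch' tr' eqw len' => [-> //|[e1 t1] w'] /=.
  move=> [-> via _ ch'] /and5P[_ _ _ _ /andP[old tr']] eqw len' stamp_gt.
  split; first by lia.
  apply: runs_loop_free => //; exists w'; have [-> ->] := find_stepE s2.
  rewrite !(framed_arr fr2) // !(framed_arr fr1) // via.
  rewrite (framed_reg fr2 rEdge) // (framed_reg fr1 rEdge) // edge_e.
  have := chain_stamp_le ch' old; rewrite eqw inE (eq_sym e).
  by case: (e1 =P e) => /= _ stamp_le; split=> //; rewrite ?orbT //; lia.
- move=> k s2 fr2 [w' [ch' tr' -> found1 _]].
  rewrite cond // => /eqP; rewrite subn_eq0 => stamp_le.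
  have -> : (e \in unzip1 w') = false.
    apply/negP; case: w' ch' tr' stamp_le => // et w' [-> _ _ _] tr' stamp_le.
    by move=> /(trail_head_time tr'); rewrite leqNgt stamp_le.
  by rewrite orbF; case: (reg s2 rFound) found1 => [|[]].
- by rewrite /=; lia.
Qed.

(** * Processing a record *)

Hypothesis span_le : forall i, i < m -> last_time es i - first_time es i <= D.
Hypothesis cover_le : forall t, coverage es m t <= D.*2.+1.

Section Process.

Variables (t : nat) (base : seq search_record) (r : search_record).

Hypothesis good : good_record es starts t r.

Definition processing acc s :=
  searching t base acc s /\ onth base (reg s rLo) = Some r.

Lemma processing_supported acc :
  supported [:: rNow; rTop; rLo] (graph_arrays ++ record_arrays ++ [:: aSeen])
    (processing acc).
Proof.
move=> s s' eq_reg eq_arr [srch cur]; split; last by rewrite eq_reg.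
exact: supported_weaken (@searching_supported _ _ _) _ _ eq_reg eq_arr srch.
Qed.

Lemma processing_record acc s : processing acc s -> record_at s (reg s rLo) r.
Proof.
move=> [[_ _ st _] cur]; apply: stored_onth st _.
by rewrite onth_cat -onthTE cur.
Qed.

Lemma processing_lo_lt acc s : processing acc s -> reg s rLo < reg s rTop.
Proof.
move=> [[_ _ [-> _] _] cur].
by rewrite size_cat ltn_addr // -onthTE cur.
Qed.

Definition pending todo s := bucket s (reg s rPtr) todo.

Lemma pending_supported todo : supported [:: rPtr] [:: aNext; aEdge] (pending todo).
Proof.
move=> s s' eq_reg eq_arr; rewrite /pending eq_reg //.
by apply: eq_bucket; exact: eq_arr_same_cells.
Qed.

Lemma pending_nil s todo : pending todo s -> (reg s rPtr == 0) = nilp todo.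
Proof. by rewrite /pending; case: todo => [->//|e l [h _ _ _]]; rewrite eqn0Ngt h. Qed.

Lemma runs_advance e todo s :
  pending (e :: todo) s -> runs advance s 3 (pending todo).
Proof.
case=> _ _ _ bk; apply: runs_loop_free => //.
by rewrite /pending; apply: eq_bucket bk.
Qed.

Lemma active_lt e : e \in active es m t -> e < m.
Proof. by rewrite mem_active => /andP[]. Qed.

Lemma size_active_bound : size (active es m t) <= D.*2.+1.
Proof. exact: leq_trans (size_active_le _ _ _) (cover_le t). Qed.

Lemma runs_lookup acc s e todo : processing acc s -> pending (e :: todo) s ->
  e \in active es m t ->
  runs lookup s (22 * D + 13) (fun s' =>
    [/\ processing acc s', pending (e :: todo) s', reg s' rEdge = e
      & reg s' rFound = (e \in unzip1 r.2)]).
Proof.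
move=> proc pend act; have em : e < m by move: act; rewrite mem_active => /andP[].
apply: (runs_seq_loop_free (T2 := 22 * D + 10)) => // [s1 fr1 eq1|];
  last by rewrite /=; lia.
have edge1 : reg s1 rEdge = e by rewrite eq1 /=; case: pend.
have proc1 := framed_supported (@processing_supported _) fr1 isT proc.
have [[[edges _] _ _ _] _] := proc1; have [_ _ first_e _ _] := edges e em.
have [_ _ _ ch] := processing_record proc1; have [_ tr old _] := good.
apply: runs_weaken (runs_find first_e edge1 tr ch (n := D) _) _ _ => //.
  apply: leq_trans (span_le em); rewrite leq_sub2r //.
  apply: leq_trans (chain_stamp_le ch old) (last_time_ge _).
  by move: act; rewrite mem_active => /andP[].
move=> s2 fr2 found; split=> //.
- exact: framed_supported (@processing_supported _) fr2 isT proc1.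
- apply: framed_supported (@pending_supported _) fr2 isT _.
  exact: framed_supported (@pending_supported _) fr1 isT pend.
- by rewrite (framed_reg fr2 rEdge).
Qed.

Definition uncovered (w : seq (nat * nat)) e :=
  (e \notin unzip1 w) && (last_time es e <= t).

Definition missing w := count (uncovered w) (active es m t).

Lemma complete_missing w : complete es t w = (missing w == 0).
Proof.
rewrite /missing -leqn0 leqNgt -has_count -all_predC; apply: eq_all => e.
by rewrite /= /uncovered implybE negb_and negbK orbC.
Qed.

Lemma complete_cons_missing w e : e \in active es m t -> e \notin unzip1 w ->
  complete es t ((e, t) :: w) = (missing w - (last_time es e <= t) == 0).
Proof.
move=> act new; rewrite /missing (permP (perm_to_rem act)) /= {1}/uncovered new addKn.
rewrite /complete (perm_all _ (perm_to_rem act)) /= mem_head implybT /=.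
rewrite -leqn0 leqNgt -has_count -all_predC; apply: eq_in_all => e'.
rewrite (mem_rem_uniq e (active_uniq _ _ _)) inE => /andP[/negbTE ne _] /=.
by rewrite inE ne /= /uncovered implybE negb_and negbK orbC.
Qed.

Lemma runs_missing_step acc s e todo : processing acc s -> pending (e :: todo) s ->
  e \in active es m t ->
  runs missing_step s (22 * D + 36) (fun s' =>
    [/\ processing acc s', pending todo s'
      & reg s' rMissing = reg s rMissing + uncovered r.2 e]).
Proof.
move=> proc pend act.
apply: (runs_seq (T2 := 20) (runs_lookup proc pend act)); last by lia.
move=> s1 fr1 [proc1 pend1 edge1 found1].
apply: (runs_seq (T1 := 16) (T2 := 3)
  (Q1 := fun s2 => reg s2 rMissing = reg s rMissing + uncovered r.2 e)) => //.
  apply: runs_loop_free => //=.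
  have [[[edges _] now _ _] _] := proc1.
  have [_ _ _ last_e _] := edges e (active_lt act).
  rewrite found1 edge1 last_e now addn_eq0 subn_eq0 eqb0 -/(uncovered r.2 e).
  by case: (uncovered r.2 e); rewrite /= (framed_reg fr1 rMissing) // addn0.
move=> s2 fr2 missing2.
have pend2 := framed_supported (@pending_supported _) fr2 isT pend1.
apply: runs_weaken (runs_advance pend2) _ (leqnn _) => s3 fr3 pend3; split=> //.
  apply: framed_supported (@processing_supported _) fr3 isT _.
  exact: framed_supported (@processing_supported _) fr2 isT proc1.
by rewrite (framed_reg fr3 rMissing).
Qed.

Lemma runs_count_missing acc s : processing acc s ->
  runs count_missing s (D.*2.+1 * (22 * D + 40) + 10)
    (fun s' => processing acc s' /\ reg s' rMissing = missing r.2).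
Proof.
move=> proc.
apply: (runs_seq_loop_free (T2 := D.*2.+1 * (22 * D + 40) + 4)) => // [s1 fr1 eq1|];
  last by rewrite /=; lia.
have proc1 := framed_supported (@processing_supported _) fr1 isT proc.
apply: (runs_while_seq (L := active es m t) (C := 22 * D + 36)
  (I := fun done todo s2 =>
     [/\ processing acc s2, pending todo s2
       & reg s2 rMissing = count (uncovered r.2) done])).
- split=> //; last by rewrite eq1.
  have [[[_ lists] now _ _] _] := proc.
  by rewrite /pending eq1 /= now; apply: eq_bucket (lists t).
- move=> done e todo s2 fr2 eqL [proc2 pend2 count2].
  split; first by rewrite (pending_nil pend2).
  have act : e \in active es m t by rewrite eqL mem_cat mem_head orbT.
  apply: runs_weaken (runs_missing_step proc2 pend2 act) _ (leqnn _).
  move=> s3 _ [proc3 pend3 count3]; split=> //.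
  by rewrite count3 count2 -cats1 count_cat /= addn0.
- move=> s2 fr2 [proc2 pend2 count2].
  by split; first by apply/eqP; rewrite (pending_nil pend2).
- have := leq_mul size_active_bound (leqnn (22 * D + 40)).
  by rewrite /=; lia.
Qed.

Definition linked s (w : seq (nat * nat)) : Prop :=
  if w is et :: w' then
    [/\ reg s rNewStamp = et.2.+1, reg s rNewVia = et.1, reg s rNewParent < reg s rTop
      & chain s (reg s rNewParent) w']
  else reg s rNewStamp = 0.

(* The registers describe the record [r'], which has the same origin as the
   current record. *)
Definition drafted (r' : search_record) s :=
  [/\ arr s aOrigin (reg s rLo) = origin r',
      reg s rNewVertex = endpoint es (origin r') r'.2, reg s rNewCode = code r'
    & linked s r'.2].

Lemma stored_append R r' s : stored R s -> drafted r' s ->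
  stored (rcons R r') (run_loop_free append_record s).
Proof.
move=> [top recs] [origin' vertex' code' linked'].
split=> [|q]; rewrite size_rcons; first by rewrite /= top addn1.
rewrite ltnS leq_eqVlt nth_rcons => /orP[/eqP->|lt].
  rewrite ltnn eqxx -top; split; rewrite /= ?eqxx //.
  case: r'.2 linked' => [|et w] /=; rewrite !eqxx //; case=> -> -> lt ch.
  split=> //; apply: eq_chain ch => a i a_in i_lt; have := ltn_eqF (leq_trans i_lt lt).
  by move: a_in; rewrite !inE => /or3P[]/eqP-> /= ->.
rewrite lt; apply: eq_record_at (recs q lt) => a i a_in i_le.
have i_top : (i == reg s rTop) = false by apply/ltn_eqF; rewrite top (leq_trans i_le).
have /negbTE not_seen : a != aSeen by move: a_in; rewrite !inE; lia.
by rewrite /= i_top !andbF not_seen.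
Qed.

Lemma marked_append acc r' s : marked t acc s -> reg s rNow = t ->
  reg s rNewCode = code r' -> marked t (rcons acc r') (run_loop_free append_record s).
Proof.
move=> mk now code' c; rewrite map_rcons mem_rcons inE /= now code' addn1.
by case: (eqVneq c (code r')) => [->|_] /=; [rewrite eqxx|exact: mk].
Qed.

Lemma runs_push acc r' s : processing acc s -> drafted r' s ->
  runs push_record s 50 (processing (push acc r')).
Proof.
move=> proc draft; have [[ld now st mk] cur] := proc; have [_ _ code' _] := draft.
have fr := run_loop_free_framed s (isT : loop_free append_record).
apply: runs_loop_free => //.
have -> : run_loop_free push_record s =
    if code r' \in map code acc then s else run_loop_free append_record s.
  by rewrite -(mk _).2 -diff_eq0 -[t.+1]addn1 -now -code'.
rewrite /push; case: ifP => // _; split; last by rewrite (framed_reg fr rLo).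
split.
- exact: framed_supported @loaded_supported fr isT ld.
- by rewrite (framed_reg fr rNow).
- by rewrite -rcons_cat; exact: stored_append.
- exact: marked_append.
Qed.

Lemma drafted_copy acc s :
  processing acc s -> drafted r (run_loop_free copy_record s).
Proof.
move=> proc; have lo_top := processing_lo_lt proc.
have [origin_r vertex_r code_r ch] := processing_record proc.
split=> //; move: ch; rewrite /linked /=; case: r.2 => [|et w] //= [-> -> lt ch].
split=> //; first exact: ltn_trans lo_top.
exact: eq_chain ch.
Qed.

Lemma runs_keep acc s : processing acc s -> reg s rMissing = missing r.2 ->
  runs keep s 90
    (processing (foldl push acc (if complete es t r.2 then [:: r] else [::]))).
Proof.
move=> proc miss; apply: (runs_if (T := 80)) => // /=;
  rewrite miss complete_missing.
  by move=> /negbTE->; exact: runs_loop_free.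
move=> ->; apply: (runs_seq_loop_free (T2 := 50)) => // s1 fr1 eq1.
apply: runs_push; first exact: framed_supported (@processing_supported _) fr1 isT proc.
by rewrite eq1; exact: drafted_copy proc.
Qed.

Lemma cannot_extendE acc s e : processing acc s -> reg s rMissing = missing r.2 ->
  reg s rEdge = e -> reg s rFound = (e \in unzip1 r.2) -> e \in active es m t ->
  (eval s cannot_extend == 0) = extends es starts t r e.
Proof.
move=> proc miss edge_e found act; have [[[edges _] now _ _] _] := proc.
have [end1_e end2_e _ last_e _] := edges e (active_lt act).
have [_ vertex_r _ _] := processing_record proc.
rewrite /= found miss edge_e end1_e end2_e last_e now vertex_r !addn_eq0 eqb0 /extends.
case: (boolP (e \in _)) => //= new; rewrite complete_cons_missing //; congr (_ && _).
  by rewrite -minnE -leqn0 geq_min !leqn0 !diff_eq0.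
by congr (_ - _ == 0); case: leqP; lia.
Qed.

Lemma drafted_extend acc s e : processing acc s -> reg s rEdge = e -> e < m ->
  drafted (r.1, (e, t) :: r.2) (run_loop_free extend_record s).
Proof.
move=> proc edge_e em; have lo_top := processing_lo_lt proc.
have [[[edges _] now _ _] _] := proc; have [end1_e end2_e _ _ weight_e] := edges e em.
have [origin_r vertex_r code_r ch] := processing_record proc.
split=> //=.
- by rewrite edge_e end1_e end2_e vertex_r.
- by rewrite edge_e code_r weight_e /code /= big_cons addnA addnAC.
- by rewrite /linked /= now addn1 edge_e; split=> //; exact: eq_chain ch.
Qed.

Definition push_extension acc e :=
  if extends es starts t r e then push acc (r.1, (e, t) :: r.2) else acc.

Lemma foldl_push_extension acc L :
  foldl push acc [seq (r.1, (e, t) :: r.2) | e <- L & extends es starts t r e] =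
  foldl push_extension acc L.
Proof. by elim: L acc => //= e L IH acc; rewrite /push_extension; case: ifP => /=. Qed.

Lemma runs_extend_step acc s e todo : processing acc s -> pending (e :: todo) s ->
  reg s rMissing = missing r.2 -> e \in active es m t ->
  runs extend_step s (22 * D + 190) (fun s' =>
    pending todo s' /\ processing (push_extension acc e) s').
Proof.
move=> proc pend miss act.
apply: (runs_seq (T2 := 170) (runs_lookup proc pend act)); last by lia.
move=> s1 fr1 [proc1 pend1 edge1 found1].
apply: (runs_seq (T1 := 160) (T2 := 3) (Q1 := processing (push_extension acc e))) => //.
  have miss1 : reg s1 rMissing = missing r.2 by rewrite (framed_reg fr1 rMissing).
  rewrite /push_extension -(cannot_extendE proc1 miss1 edge1 found1 act).
  apply: (runs_if (T := 90)) => // [/negbTE->|->]; first exact: runs_loop_free.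
  apply: (runs_seq_loop_free (T2 := 50)) => // s2 fr2 eq2.
  apply: runs_push.
    exact: framed_supported (@processing_supported _) fr2 isT proc1.
  by rewrite eq2; apply: drafted_extend proc1 edge1 (active_lt act).
move=> s2 fr2 proc2.
have pend2 := framed_supported (@pending_supported _) fr2 isT pend1.
apply: runs_weaken (runs_advance pend2) _ (leqnn _) => s3 fr3 pend3; split=> //.
exact: framed_supported (@processing_supported _) fr3 isT proc2.
Qed.

Lemma runs_extend acc s : processing acc s -> reg s rMissing = missing r.2 ->
  runs extend s (D.*2.+1 * (22 * D + 200) + 10)
    (processing (foldl push acc (extensions es starts t r))).
Proof.
move=> proc miss.
apply: (runs_seq_loop_free (T2 := D.*2.+1 * (22 * D + 200) + 4)) => // [s1 fr1 eq1|];
  last by rewrite /=; lia.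
have proc1 := framed_supported (@processing_supported _) fr1 isT proc.
rewrite /extensions foldl_push_extension.
apply: (runs_while_seq (L := active es m t) (C := 22 * D + 190)
  (I := fun done todo s2 =>
     pending todo s2 /\ processing (foldl push_extension acc done) s2)).
- split=> //; have [[[_ lists] now _ _] _] := proc.
  by rewrite /pending eq1 /= now; apply: eq_bucket (lists t).
- move=> done e todo s2 fr2 eqL [pend2 proc2].
  split; first by rewrite (pending_nil pend2).
  have act : e \in active es m t by rewrite eqL mem_cat mem_head orbT.
  have miss2 : reg s2 rMissing = missing r.2.
    by rewrite (framed_reg fr2 rMissing) // (framed_reg fr1 rMissing).
  apply: runs_weaken (runs_extend_step proc2 pend2 miss2 act) _ (leqnn _).
  by move=> s3 _ [pend3 proc3]; rewrite foldl_rcons.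
- by move=> s2 _ [pend2 proc2]; split=> //; apply/eqP; rewrite (pending_nil pend2).
- have := leq_mul size_active_bound (leqnn (22 * D + 200)).
  by rewrite /=; lia.
Qed.

Definition process_time := D.*2.+1 * (22 * D + 40) + D.*2.+1 * (22 * D + 200) + 120.

Lemma runs_process_record acc s : processing acc s ->
  runs process_record s process_time (fun s' =>
    searching t base (foldl push acc (successors es starts t r)) s' /\
    reg s' rLo = (reg s rLo).+1).
Proof.
move=> proc.
apply: (runs_seq (T2 := D.*2.+1 * (22 * D + 200) + 110) (runs_count_missing proc));
  last by rewrite /process_time; lia.
move=> s1 fr1 [proc1 miss1].
apply: (runs_seq (T2 := D.*2.+1 * (22 * D + 200) + 20) (runs_keep proc1 miss1));
  last by lia.
move=> s2 fr2 proc2; have miss2 : reg s2 rMissing = missing r.2.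
  by rewrite (framed_reg fr2 rMissing).
apply: (runs_seq (T2 := 4) (runs_extend proc2 miss2)); last by lia.
move=> s3 fr3 [srch3 _].
have fr4 := run_loop_free_framed s3 (isT : loop_free (Incr rLo)).
apply: runs_loop_free => //; rewrite /successors foldl_cat; split.
  exact: framed_supported (@searching_supported _ _ _) fr4 isT srch3.
rewrite /= addn1 (framed_reg fr3 rLo) // (framed_reg fr2 rLo) //.
by rewrite (framed_reg fr1 rLo).
Qed.

End Process.

(** * The sweep over time *)

Hypothesis loopless : forall i, i < m -> end1 es i != end2 es i.
Hypothesis nonempty : forall i, i < m -> times es i != [::].

Definition swept t s := exists old,
  [/\ loaded s, reg s rNow = t, stored (old ++ search es starts t) s,
      reg s rLo = size old /\ reg s rHi = reg s rTop & forall c, arr s aSeen c <= t].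

Definition max_records := size starts * 2 ^ D.*2.+1.

Lemma size_search_bound t : size (search es starts t) <= max_records.
Proof.
apply: leq_trans (size_search_le loopless nonempty starts t) _.
by rewrite leq_mul2l leq_exp2l // cover_le orbT.
Qed.

Lemma runs_time_step s t : swept t s ->
  runs time_step s (max_records * (process_time + 4) + 10) (swept t.+1).
Proof.
move=> [old [ld now st [lo hi] seen_le]].
have [sound _ _] := searchP loopless nonempty starts t.
set L := search es starts t in st sound.
have hi_size : reg s rHi = size old + size L by rewrite hi st.1 size_cat.
apply: (runs_seq (T1 := max_records * (process_time + 4) + 4) (T2 := 6)
  (Q1 := fun s1 => searching t (old ++ L) (search es starts t.+1) s1 /\
                   reg s1 rLo = size (old ++ L))); last by lia.
  apply: (runs_while_seq (L := L) (C := process_time) (I := fun done _ s1 =>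
    searching t (old ++ L)
      (foldl push [::] (flatten (map (successors es starts t) done))) s1 /\
    reg s1 rLo = size (old ++ done))).
  - rewrite /searching /= !cats0; split=> //; split=> // c; split; first exact: leqW.
    by rewrite ltn_eqF // ltnS.
  - move=> done r todo s1 fr1 eqL [srch1 lo1].
    split.
      by rewrite /= lo1 (framed_reg fr1 rHi) // hi_size eqL !size_cat /=; lia.
    have good : good_record es starts t r.
      by apply: sound; rewrite eqL mem_cat mem_head orbT.
    apply: runs_weaken (runs_process_record good (conj srch1 _)) _ (leqnn _).
      by rewrite lo1 eqL catA onth_cat ltnn subnn.
    move=> s2 _ [srch2 lo2]; rewrite map_rcons flatten_rcons foldl_cat; split=> //.
    by rewrite lo2 lo1 !size_cat size_rcons addnS.
  - move=> s1 fr1 [srch1 lo1]; split=> //.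
    by rewrite /= lo1 (framed_reg fr1 rHi) // hi_size size_cat subnn.
  - have := leq_mul (size_search_bound t) (leqnn (process_time + 4)).
    by rewrite /= -/L; lia.
move=> s1 fr1 [[ld1 now1 st1 mk1] lo1].
have fr2 := run_loop_free_framed s1 (isT : loop_free next_time).
apply: runs_loop_free => //; exists (old ++ L); split.
- exact: framed_supported @loaded_supported fr2 isT ld1.
- by rewrite /= now1 addn1.
- exact: framed_supported (@stored_supported _) fr2 isT st1.
- by rewrite (framed_reg fr2 rLo).
- by move=> c; rewrite (framed_arr fr2) //; have [] := mk1 c.
Qed.

Definition sweep_time := horizon es m * (max_records * (process_time + 4) + 14) + 20.

Lemma runs_sweep s : loaded s -> reg s rHorizon = horizon es m ->
  stored (search es starts 0) s -> (forall c, arr s aSeen c = 0) ->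
  runs sweep s sweep_time (swept (horizon es m)).
Proof.
move=> ld hor st unseen.
apply: (runs_seq_loop_free (T2 := sweep_time - 12)) => // [s1 fr1 eq1|];
  last by rewrite /sweep_time /=; lia.
apply: (runs_while_upto (n := horizon es m) (I := swept)
  (C := max_records * (process_time + 4) + 10)).
- exists [::]; rewrite cat0s; split.
  + exact: framed_supported @loaded_supported fr1 isT ld.
  + by rewrite eq1.
  + exact: framed_supported (@stored_supported _) fr1 isT st.
  + by rewrite eq1.
  + by move=> c; rewrite (framed_arr fr1) // unseen.
- move=> t s2 fr2 lt sw; have [_ [_ now _ _ _]] := sw.
  split; last exact: runs_time_step.
  by rewrite /= (framed_reg fr2 rHorizon) // (framed_reg fr1 rHorizon) // hor now; lia.
- move=> s2 fr2 sw; have [_ [_ now _ _ _]] := sw; split=> //.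
  by rewrite /= (framed_reg fr2 rHorizon) // (framed_reg fr1 rHorizon) // hor now subnn.
- by rewrite /sweep_time /=; lia.
Qed.

Lemma runs_accept s t : swept t s -> reg s rResult = 0 ->
  runs accept s (max_records * 30 + 4)
    (fun s' => accepting s' <-> exists2 r, r \in search es starts t & closed_record r).
Proof.
move=> [old [_ _ st [lo _] _]] result0; set L := search es starts t in st *.
have top : reg s rTop = size old + size L by rewrite st.1 size_cat.
apply: (runs_weaken (T := max_records * 30 + 4)
  (Q := fun s' => (reg s' rResult != 0) = has closed_record L)) => //; last first.
  by move=> s' _; rewrite /accepting => ->; split=> /hasP.
apply: (runs_while_seq (L := L) (C := 20) (I := fun done _ s1 =>
  reg s1 rLo = size (old ++ done) /\ (reg s1 rResult != 0) = has closed_record done)).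
- by rewrite cats0 result0.
- move=> done r todo s1 fr1 eqL [lo1 res1].
  split; first by rewrite /= lo1 (framed_reg fr1 rTop) // top eqL !size_cat /=; lia.
  have [origin_r vertex_r _ _] : record_at s (reg s1 rLo) r.
    by apply: stored_onth st _; rewrite lo1 eqL catA onth_cat ltnn subnn.
  apply: runs_loop_free => //.
  rewrite /= !(framed_arr fr1) // diff_eq0 origin_r vertex_r -/(closed_record r).
  rewrite has_rcons -rcons_cat size_rcons.
  by case: (closed_record r); rewrite /= lo1 addn1.
- move=> s1 fr1 [lo1 res1]; split=> //.
  by rewrite /= lo1 (framed_reg fr1 rTop) // top size_cat subnn.
- by have := leq_mul (size_search_bound t) (leqnn 30); rewrite /= -/L; lia.
Qed.

End Sweep.

(** * Reading the input *)

Definition read_time :=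
  Assign rTime (Read aInput (Reg rPos)) ;;
  Write aNext (Reg rPos) (Read aHead (Reg rTime)) ;;
  Write aEdge (Reg rPos) (Reg rCur) ;;
  Write aHead (Reg rTime) (Reg rPos) ;;
  Assign rFirst (Min (Reg rFirst) (Reg rTime)) ;;
  Assign rLast (Max (Reg rLast) (Reg rTime)) ;;
  Incr rPos ;;
  Assign rLeft (Sub (Reg rLeft) (Const 1)).

Definition open_edge :=
  Write aEnd1 (Reg rCur) (Read aInput (Reg rPos)) ;;
  Write aEnd2 (Reg rCur) (Read aInput (Add (Reg rPos) (Const 1))) ;;
  Assign rLeft (Read aInput (Add (Reg rPos) (Const 2))) ;;
  Assign rPos (Add (Reg rPos) (Const 3)) ;;
  Assign rFirst (Read aInput (Reg rPos)) ;;
  Assign rLast (Reg rFirst).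

Definition close_edge :=
  Write aFirst (Reg rCur) (Reg rFirst) ;;
  Write aLast (Reg rCur) (Reg rLast) ;;
  Write aWeight (Reg rCur) (Reg rWeight) ;;
  Assign rWeight (Add (Reg rWeight) (Reg rWeight)) ;;
  Assign rSpan (Max (Reg rSpan) (Sub (Reg rLast) (Reg rFirst))) ;;
  Assign rHorizon (Max (Reg rHorizon) (Add (Reg rLast) (Const 1))) ;;
  Assign rNow (Reg rFirst).

Definition cover_step :=
  Write aCover (Reg rNow) (Add (Read aCover (Reg rNow)) (Const 1)) ;;
  If (Sub (Read aCover (Reg rNow)) (Add (Add (Reg rSpan) (Reg rSpan)) (Const 1)))
    (Assign rBad (Const 1)) Skip ;;
  Incr rNow.

Definition cover_edge :=
  While (Sub (Add (Reg rLast) (Const 1)) (Reg rNow)) cover_step.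

(* Clearing [rEdges] leaves the loop over the edges. *)
Definition next_edge := Incr rCur ;; If (Reg rBad) (Assign rEdges (Const 0)) Skip.

Definition read_edge :=
  open_edge ;;
  If (Reg rLeft)
    (While (Reg rLeft) read_time ;; close_edge ;; cover_edge)
    (Assign rBad (Const 1)) ;;
  next_edge.

Definition parse :=
  (Assign rPos (Const 2) ;; Assign rWeight (Const 1)) ;;
  While (Sub (Reg rEdges) (Reg rCur)) read_edge.

Section Parse.

Variables (es : seq (nat * nat * seq nat)) (D N : nat).

Local Notation m := (size es).
Local Notation edges_upto := (edges_upto es).

Hypothesis times_uniq : forall i, i < m -> uniq (times es i).
Hypothesis span_le : forall i, i < m -> last_time es i - first_time es i <= D.
Hypothesis last_lt : forall i, i < m -> last_time es i < N.

Definition edge_word (r : nat * nat * seq nat) : seq nat :=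
  [:: r.1.1, r.1.2, size r.2 & r.2].

Definition words_from i := flatten [seq edge_word r | r <- drop i es].

Lemma words_fromE i : i < m ->
  words_from i =
  [:: end1 es i, end2 es i, size (times es i) & times es i ++ words_from i.+1].
Proof. by move=> im; rewrite /words_from (drop_nth (0, 0, [::]) im). Qed.

Definition input_at p (w : seq nat) s := forall j, arr s aInput (p + j) = nth 0 w j.

Lemma input_at_supported p w : supported [::] [:: aInput] (input_at p w).
Proof. by move=> s s' _ eq_arr inp j; rewrite eq_arr. Qed.

Lemma input_at_cons p x w s :
  input_at p (x :: w) s -> arr s aInput p = x /\ input_at p.+1 w s.
Proof. by move=> inp; split=> [|j]; [rewrite -[p]addn0 inp|rewrite addSnnS inp]. Qed.

Definition control i s := [/\ reg s rCur = i, reg s rEdges = m & reg s rBad = 0].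

Definition counters n s :=
  [/\ reg s rWeight = 2 ^ n, reg s rSpan = max_span es n
    & reg s rHorizon = horizon es n].

Lemma counters_supported n : supported [:: rWeight; rSpan; rHorizon] [::] (counters n).
Proof. by move=> s s' eq_reg _ [? ? ?]; split; rewrite eq_reg. Qed.

Definition covers n s := forall t, arr s aCover t = coverage es n t.

Lemma covers_supported n : supported [::] [:: aCover] (covers n).
Proof. by move=> s s' _ eq_arr cov t; rewrite eq_arr. Qed.

Definition lists (act : nat -> seq nat) s :=
  forall t, bucket s (arr s aHead t) (act t) /\ arr s aHead t < reg s rPos.

Lemma lists_supported act : supported [:: rPos] list_arrays (lists act).
Proof.
move=> s s' eq_reg eq_arr ls t; have [bk lt] := ls t.
rewrite eq_arr // eq_reg //; split=> //; apply: eq_bucket bk.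
exact: same_cells_weaken (eq_arr_same_cells eq_arr).
Qed.

Definition read_upto n s :=
  [/\ edges_upto n s, counters n s, covers n s
    & lists (active es n) s /\ input_at (reg s rPos) (words_from n) s].

Lemma read_upto_supported n :
  supported [:: rPos; rWeight; rSpan; rHorizon]
    (aInput :: aCover :: graph_arrays) (read_upto n).
Proof.
move=> s s' eq_reg eq_arr [edges count cov [ls inp]]; split.
- exact: supported_weaken (@edges_upto_supported _ _) _ _ eq_reg eq_arr edges.
- exact: supported_weaken (@counters_supported _) _ _ eq_reg eq_arr count.
- exact: supported_weaken (@covers_supported _) _ _ eq_reg eq_arr cov.
split; first exact: supported_weaken (@lists_supported _) _ _ eq_reg eq_arr ls.
by rewrite eq_reg // => j; rewrite eq_arr.
Qed.

(* The times [done] of edge [i] have been read, the times [todo] have not. *)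
Definition scanning i (done todo : seq nat) s :=
  [/\ reg s rLeft = size todo, input_at (reg s rPos) (todo ++ words_from i.+1) s,
      reg s rFirst = \big[minn/head 0 (times es i)]_(t <- done) t,
      reg s rLast = \big[maxn/head 0 (times es i)]_(t <- done) t
    & lists (fun t => if t \in done then i :: active es i t else active es i t) s].

Lemma run_open_edge i s : i < m -> control i s -> read_upto i s ->
  let s' := run_loop_free open_edge s in
  [/\ edges_upto i s', arr s' aEnd1 i = end1 es i, arr s' aEnd2 i = end2 es i,
      reg s' rLeft = size (times es i)
    & times es i != [::] -> scanning i [::] (times es i) s'].
Proof.
move=> im [cur _ _] [edges _ _ [ls inp]] s'.
have fr : framed open_edge s s' by exact: run_loop_free_framed.
rewrite words_fromE // in inp.
have [end1_in inp1] := input_at_cons inp; have [end2_in inp2] := input_at_cons inp1.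
have [size_in inp'] := input_at_cons inp2.
have head_in : arr s aInput (reg s rPos + 3) = head 0 (times es i ++ words_from i.+1).
  by rewrite addn3 -[_.+3]addn0 inp'; case: (_ ++ _).
split.
- move=> j ji; have [? ? ? ? ?] := edges j ji.
  by split; first [by rewrite (framed_arr fr)|by rewrite /s' /= cur (ltn_eqF ji)].
- by rewrite /s' /= cur eqxx.
- by rewrite /s' /= cur eqxx addn1.
- by rewrite /s' /= addn2.
move=> ne; split.
- by rewrite /s' /= addn2.
- by move=> j; rewrite /s' /= addn3; exact: inp'.
- by rewrite big_nil /s' /= head_in; case: (times es i) ne.
- by rewrite big_nil /s' /= head_in; case: (times es i) ne.
move=> t; have [bk lt] := ls t; rewrite !(framed_arr fr) //.
split; last by rewrite /s' /=; lia.
apply: eq_bucket bk => a j + _; rewrite !inE.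
by case/orP=> /eqP->; rewrite (framed_arr fr).
Qed.

Lemma run_read_time i done x todo s : reg s rCur = i ->
  x \notin done -> scanning i done (x :: todo) s ->
  scanning i (rcons done x) todo (run_loop_free read_time s).
Proof.
move=> cur new [left inp fst lst ls]; have [x_in inp'] := input_at_cons inp.
split.
- by rewrite /= left subn1.
- by move=> j; rewrite /= addn1; exact: inp'.
- by rewrite (big_rcons_AC _ _ _ _ minnA minnC) /= x_in fst -minnE.
- by rewrite (big_rcons_AC _ _ _ _ maxnA maxnC) /= x_in lst -maxnE.
set s' := run_loop_free read_time s => t; have [bk lt] := ls t.
have older h l : h < reg s rPos -> bucket s h l -> bucket s' h l.
  move=> h_lt; apply: eq_bucket => a j + j_le.
  by rewrite !inE => /orP[]/eqP->; rewrite /= (ltn_eqF (leq_trans j_le h_lt)).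
have head_s' : arr s' aHead t = if t == x then reg s rPos else arr s aHead t.
  by rewrite /s' /= x_in.
have -> : reg s' rPos = (reg s rPos).+1 by rewrite /s' /= addn1.
rewrite head_s' mem_rcons inE; case: (eqVneq t x) => [eq_t|ne] /=; last first.
  by split; [exact: older|exact: leqW].
subst t; rewrite (negbTE new) in bk; split=> //.
rewrite /= eqxx x_in cur; split=> //; last exact: older.
exact: leq_ltn_trans lt.
Qed.

Lemma runs_scan i s : i < m -> reg s rCur = i -> scanning i [::] (times es i) s ->
  runs (While (Reg rLeft) read_time) s (size (times es i) * 50 + 2)
    (scanning i (times es i) [::]).
Proof.
move=> im cur scan.
apply: (runs_while_seq (L := times es i) (C := 48) (I := scanning i)) => //.
- move=> done x todo s1 fr1 eqL scan1.
  split; first by rewrite /=; have [-> _ _ _ _] := scan1.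
  apply: runs_loop_free => //; apply: run_read_time scan1.
    by rewrite (framed_reg fr1 rCur).
  have := times_uniq im; rewrite eqL -cat_rcons cat_uniq rcons_uniq.
  by case/andP=> /andP[].
- by move=> s1 _ scan1; have [left _ _ _ _] := scan1.
- by rewrite /=; lia.
Qed.

Lemma run_close_edge i s : control i s -> edges_upto i s -> counters i s ->
  arr s aEnd1 i = end1 es i -> arr s aEnd2 i = end2 es i ->
  scanning i (times es i) [::] s ->
  let s' := run_loop_free close_edge s in
  [/\ edges_upto i.+1 s', counters i.+1 s', reg s' rNow = first_time es i
    & reg s' rLast = last_time es i].
Proof.
move=> [cur _ _] edges [weight span horizon_i] end1_i end2_i [_ _ fst lst _] s'.
have fr : framed close_edge s s' by exact: run_loop_free_framed.
split.
- move=> j; rewrite ltnS leq_eqVlt => /orP[/eqP->|ji].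
    by split; first [by rewrite (framed_arr fr)|by rewrite /s' /= cur eqxx].
  have [? ? ? ? ?] := edges j ji.
  by split; first [by rewrite (framed_arr fr)|by rewrite /s' /= cur (ltn_eqF ji)].
- split; rewrite /s' /=.
  + by rewrite weight addnn -mul2n expnS.
  + by rewrite span fst lst -maxnE /max_span big_ord_recr.
  + by rewrite horizon_i lst addn1 -maxnE /horizon big_ord_recr.
- by rewrite /s' /= fst.
- by rewrite /s' /= lst.
Qed.

Definition overfull i t := (max_span es i).*2.+1 < coverage es i t.

Definition period i := iota (first_time es i) ((last_time es i).+1 - first_time es i).

Lemma mem_period i t : times es i != [::] -> (t \in period i) = straddles es t i.
Proof. by move=> /first_le_last le; rewrite mem_iota subnKC ?ltnS // leqW. Qed.

Lemma run_cover_step s i t : reg s rNow = t -> reg s rSpan = max_span es i ->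
  arr s aCover t + 1 = coverage es i t ->
  let s' := run_loop_free cover_step s in
  [/\ reg s' rNow = t.+1, (reg s' rBad != 0) = (reg s rBad != 0) || overfull i t
    & forall t', arr s' aCover t' = arr s aCover t' + (t' == t)].
Proof.
move=> now span cover_t s'.
have over_t :
    (coverage es i t - (max_span es i + max_span es i + 1) == 0) = ~~ overfull i t.
  by rewrite subn_eq0 -leqNgt addnn addn1.
rewrite /s' /= now span eqxx /= cover_t over_t.
split.
- by case: (overfull i t); rewrite /= now addn1.
- by case: (overfull i t); rewrite /= ?orbT ?orbF.
- move=> t'; case: (overfull i t) => /=;
    by case: (eqVneq t' t) => [->|_]; rewrite ?addn0 ?cover_t.
Qed.

Lemma runs_cover_edge i s : i < m -> times es i != [::] -> covers i s ->
  reg s rNow = first_time es i -> reg s rLast = last_time es i ->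
  reg s rSpan = max_span es i.+1 -> reg s rBad = 0 ->
  runs cover_edge s (D.+1 * 40 + 6) (fun s' => covers i.+1 s' /\
    (reg s' rBad != 0) = has (overfull i.+1) (period i)).
Proof.
move=> im ne cov now last_i span bad; rewrite /period; set n := _.+1 - _.
have first_last := first_le_last ne.
apply: (runs_while_upto (n := n) (C := 34) (I := fun k s1 =>
  [/\ reg s1 rNow = first_time es i + k,
      (reg s1 rBad != 0) = has (overfull i.+1) (iota (first_time es i) k)
    & forall t, arr s1 aCover t =
        coverage es i t + (first_time es i <= t < first_time es i + k)])).
- rewrite now bad addn0; split=> // t; rewrite cov.
  by rewrite ltnNge andbN addn0.
- move=> k s1 fr1 k_lt [now1 bad1 cov1].
  split.
    by rewrite /= now1 (framed_reg fr1 rLast) // last_i; move: k_lt; rewrite /n; lia.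
  have span1 : reg s1 rSpan = max_span es i.+1 by rewrite (framed_reg fr1 rSpan).
  have cover_now : arr s1 aCover (first_time es i + k) + 1 =
      coverage es i.+1 (first_time es i + k).
    rewrite cov1 ltnn andbF addn0 coverageS /straddles leq_addr.
    by move: k_lt; rewrite /n; case: leqP; lia.
  apply: runs_loop_free => //.
  have [now2 bad2 cov2] := run_cover_step now1 span1 cover_now; split.
  + by rewrite now2 addnS.
  + by rewrite bad2 bad1 iota_rcons has_rcons orbC.
  + move=> t; rewrite cov2 cov1 -addnA; congr (_ + _).
    by case: (ltngtP t (first_time es i + k)); lia.
- move=> s1 fr1 [now1 bad1 cov1]; split.
    by rewrite /= now1 (framed_reg fr1 rLast) // last_i /n; lia.
  split=> // t; rewrite cov1 coverageS; congr (_ + _).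
  by rewrite /straddles /n subnKC ?ltnS // leqW.
- by have := span_le im; rewrite /= /n; lia.
Qed.

(** * Feasible instances *)

Definition feasible n :=
  (forall i, i < n -> times es i != [::]) /\ forall t, ~~ overfull n t.

Lemma feasible0 : feasible 0.
Proof. by split=> // t; rewrite /overfull. Qed.

Lemma feasibleS n : feasible n -> feasible n.+1 <->
  times es n != [::] /\ ~~ has (overfull n.+1) (period n).
Proof.
move=> [nonempty balanced]; split=> [[nonempty' balanced']|[ne not_over]].
  by split; [exact: nonempty'|apply/hasPn => t _; exact: balanced'].
split=> [i|t]; first by rewrite ltnS leq_eqVlt => /orP[/eqP->|/nonempty].
case: (boolP (straddles es t n)) => [str|/negbTE not_str].
  by apply: (hasPn not_over); rewrite mem_period.
rewrite /overfull coverageS not_str addn0 -leqNgt.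
have := balanced t; rewrite /overfull -leqNgt => /leq_trans -> //.
by rewrite ltnS leq_double /max_span big_ord_recr leq_maxl.
Qed.

Lemma eulerian_trail_feasible x w n : eulerian_trail es x w -> n <= m -> feasible n.
Proof.
move=> [tr sz _] n_le; split=> [i lt|t].
  have : i \in unzip1 w by rewrite (mem_covering_trail _ tr sz) (leq_trans lt).
  by move=> /(trail_time tr)[t _]; case: (times es i).
rewrite /overfull -leqNgt; apply: coverage_le_trail tr sz n_le _ => i.
exact: span_le_max_span.
Qed.

Lemma feasible_coverage_le n t : n <= m -> feasible n -> coverage es n t <= D.*2.+1.
Proof.
move=> n_le [_ /(_ t)]; rewrite /overfull -leqNgt => /leq_trans -> //.
rewrite ltnS leq_double; apply/bigmax_leqP => i _; apply: span_le.
exact: leq_trans (ltn_ord i) n_le.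
Qed.

Definition max_edges := N * D.*2.+1.

Lemma feasible_le n : n <= m -> feasible n -> n <= max_edges.
Proof.
move=> n_le feas; apply: leq_trans (@leq_sum_coverage es n N _) _.
  move=> i lt; rewrite last_lt ?(leq_trans lt) // andbT.
  by apply: first_le_last; exact: feas.1.
rewrite /max_edges -[N in _ <= N * _]card_ord -sum_nat_const.
by apply: leq_sum => t _; exact: feasible_coverage_le.
Qed.

Lemma size_times_le i : i < m -> size (times es i) <= D.+1.
Proof.
move=> im; rewrite -(size_iota (first_time es i) D.+1); apply: uniq_leq_size.
  exact: times_uniq.
move=> t t_in; rewrite mem_iota; have := span_le im.
by have := first_time_le t_in; have := last_time_ge t_in; lia.
Qed.

Lemma runs_scan_edge i s : i < m -> times es i != [::] -> control i s ->
  edges_upto i s -> counters i s -> covers i s ->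
  arr s aEnd1 i = end1 es i -> arr s aEnd2 i = end2 es i ->
  scanning i [::] (times es i) s ->
  runs (While (Reg rLeft) read_time ;; close_edge ;; cover_edge) s (D.+1 * 90 + 90)
    (fun s' => read_upto i.+1 s' /\
      (reg s' rBad != 0) = has (overfull i.+1) (period i)).
Proof.
move=> im ne [cur edges_m bad] edges count cov end1_i end2_i scan.
apply: (runs_seq (T2 := D.+1 * 40 + 50) (runs_scan im cur scan)); last first.
  by have := size_times_le im; lia.
move=> s1 fr1 scan1; have [_ inp1 _ _ ls1] := scan1.
apply: (runs_seq_loop_free (T2 := D.+1 * 40 + 6)) => // [s2 fr2 eq2|];
  last by rewrite /=; lia.
have [edges2 count2 now2 last2] : [/\ edges_upto i.+1 s2, counters i.+1 s2,
    reg s2 rNow = first_time es i & reg s2 rLast = last_time es i].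
  rewrite eq2; apply: run_close_edge scan1; rewrite ?(framed_arr fr1) //.
  - by split; rewrite (framed_reg fr1).
  - exact: framed_supported (@edges_upto_supported _ _) fr1 isT edges.
  - exact: framed_supported (@counters_supported _) fr1 isT count.
have cov2 : covers i s2.
  apply: framed_supported (@covers_supported _) fr2 isT _.
  exact: framed_supported (@covers_supported _) fr1 isT cov.
have [_ span2 _] := count2.
apply: runs_weaken (runs_cover_edge im ne cov2 now2 last2 span2 _) _ (leqnn _).
  by rewrite (framed_reg fr2 rBad) // (framed_reg fr1 rBad).
move=> s3 fr3 [cov3 bad3]; split=> //; split=> //.
- exact: framed_supported (@edges_upto_supported _ _) fr3 isT edges2.
- exact: framed_supported (@counters_supported _) fr3 isT count2.
have pos3 : reg s3 rPos = reg s1 rPos.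
  by rewrite (framed_reg fr3 rPos) // (framed_reg fr2 rPos).
split.
  apply: framed_supported (@lists_supported _) fr3 isT _.
  apply: framed_supported (@lists_supported _) fr2 isT _.
  by move=> t; rewrite activeS; exact: ls1.
rewrite pos3; apply: framed_supported (@input_at_supported _ _) fr3 isT _.
exact: framed_supported (@input_at_supported _ _) fr2 isT inp1.
Qed.

Definition edge_time := D.+1 * 90 + 150.

Definition parsed n s := [/\ control n s, read_upto n s & feasible n].

Definition rejected n s := [/\ reg s rBad != 0, reg s rEdges = 0 & ~ feasible n].

Lemma runs_read_edge i s : i < m -> parsed i s ->
  runs read_edge s edge_time (fun s' => parsed i.+1 s' \/ rejected i.+1 s').
Proof.
move=> im [ctrl ld feas]; have [cur edges_m bad] := ctrl; have [_ count cov _] := ld.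
apply: (runs_seq_loop_free (T2 := D.+1 * 90 + 115)) => // [s1 fr1 eq1|];
  last by rewrite /edge_time /=; lia.
have := run_open_edge im ctrl ld; rewrite -eq1 => -[edges1 end1_i end2_i left1 scan1].
apply: (runs_seq (T1 := D.+1 * 90 + 95) (T2 := 15) (Q1 := fun s2 =>
  (read_upto i.+1 s2 /\ reg s2 rBad = 0 /\ feasible i.+1) \/
  (reg s2 rBad != 0 /\ ~ feasible i.+1))); last by lia.
  apply: (runs_if (T := D.+1 * 90 + 90)); last by rewrite /=; lia.
    rewrite /= left1 size_eq0 => ne.
    have ctrl1 : control i s1 by split; rewrite (framed_reg fr1).
    have count1 := framed_supported (@counters_supported _) fr1 isT count.
    have cov1 := framed_supported (@covers_supported _) fr1 isT cov.
    have run := runs_scan_edge im ne ctrl1 edges1 count1 cov1 end1_i end2_i (scan1 ne).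
    apply: runs_weaken run _ (leqnn _) => s2 _ [ld2 bad2].
    case: (eqVneq (reg s2 rBad) 0) bad2 => [bad2 not_over|bad2 over].
      by left; split=> //; split=> //; apply/(feasibleS feas); rewrite ne -not_over.
    by right; split=> // /(feasibleS feas)[_]; rewrite -over.
  rewrite /= left1 => /size0nil t0; apply: runs_loop_free => //.
  by right; split=> // -[/(_ i (ltnSn i))]; rewrite t0.
move=> s2 fr2 read2.
have cur2 : reg s2 rCur = i by rewrite (framed_reg fr2 rCur) // (framed_reg fr1 rCur).
have edges2 : reg s2 rEdges = m.
  by rewrite (framed_reg fr2 rEdges) // (framed_reg fr1 rEdges).
have fr3 := run_loop_free_framed s2 (isT : loop_free next_edge).
apply: runs_loop_free => //; case: read2 => [[ld2 [bad2 feas2]]|[bad2 infeas2]].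
  left; split=> //; last exact: framed_supported (@read_upto_supported _) fr3 isT ld2.
  by split; rewrite /= bad2 /= ?cur2 ?addn1.
by right; split=> //; rewrite /= (negbTE bad2).
Qed.

Definition parse_time := max_edges.+1 * (edge_time + 4) + 20.

Definition fresh s :=
  (forall x, x != rEdges -> reg s x = 0) /\ (forall a i, a != aInput -> arr s a i = 0).

Lemma runs_parse s : fresh s -> reg s rEdges = m -> input_at 2 (words_from 0) s ->
  runs parse s parse_time (fun s' =>
    parsed m s' \/ (reg s' rBad != 0 /\ exists2 n, n <= m & ~ feasible n)).
Proof.
move=> [regs0 arrs0] edges_m inp.
apply: (runs_seq_loop_free (T2 := parse_time - 6)) => // [s1 fr1 eq1|];
  last by rewrite /parse_time /=; lia.
apply: (runs_while (n := max_edges.+1) (C := edge_time) (I := fun k s2 =>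
  (exists2 i, i <= m /\ i + k = max_edges.+1 & parsed i s2) \/
  exists2 i, i <= m & rejected i s2)).
- left; exists 0 => //; rewrite eq1; split; last exact: feasible0.
    by split=> //=; exact: regs0.
  split=> //.
  + by split; rewrite /= ?regs0 // /max_span /horizon big_ord0.
  + by move=> t; rewrite /= arrs0.
  + by split=> // t; rewrite /= !arrs0.
- move=> k s2 fr2 [[i [im ik] pars]|[i _ [_ edges0 _]]] /=;
    last by rewrite edges0 sub0n.
  have [[cur edges bad] _ feas] := pars; rewrite cur edges => cond.
  have := feasible_le im feas; split; first by lia.
  have lt : i < m by lia.
  apply: runs_weaken (runs_read_edge lt pars) _ (leqnn _) => s3 _ [pars3|rej3].
    by left; exists i.+1 => //; lia.
  by right; exists i.+1.
- move=> k s2 fr2 [[i [im _] pars]|[i im [bad _ infeas]]] /=; last first.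
    by move=> _; right; split=> //; exists i.
  have [[cur edges _] _ _] := pars; rewrite cur edges => cond.
  by left; rewrite (_ : m = i) //; lia.
- by rewrite /parse_time /=; lia.
Qed.

End Parse.

(** * Seeding the search *)

Definition min_step :=
  Assign rMinLast (Min (Reg rMinLast) (Read aLast (Reg rCur))) ;; Incr rCur.

Definition find_min :=
  (Assign rMinLast (Read aLast (Const 0)) ;; Assign rCur (Const 0)) ;;
  While (Sub (Reg rEdges) (Reg rCur)) min_step.

Definition add_seed a :=
  Write aOrigin (Reg rTop) (Read a (Reg rCur)) ;;
  Write aVertex (Reg rTop) (Read a (Reg rCur)) ;;
  Write aCode (Reg rTop) (Reg rBase) ;;
  Write aStamp (Reg rTop) (Const 0) ;;
  Incr rTop ;;
  Assign rBase (Add (Reg rBase) (Reg rWeight)).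

Definition seed_step :=
  If (Sub (Read aFirst (Reg rCur)) (Reg rMinLast)) Skip
    (add_seed aEnd1 ;; add_seed aEnd2) ;;
  Incr rCur.

Definition seed :=
  Assign rCur (Const 0) ;; While (Sub (Reg rEdges) (Reg rCur)) seed_step.

Definition decide := find_min ;; seed ;; sweep ;; accept.

Section Seed.

Variable es : seq (nat * nat * seq nat).

Local Notation m := (size es).
Local Notation edges_upto := (edges_upto es).

Lemma runs_find_min s : edges_upto m s -> reg s rEdges = m -> 0 < m ->
  runs find_min s (m * 20 + 20) (fun s' => reg s' rMinLast = min_last es m).
Proof.
move=> edges edges_m m0.
apply: (runs_seq_loop_free (T2 := m * 20 + 4)) => // [s1 fr1 eq1|];
  last by rewrite /=; lia.
apply: (runs_while_upto (n := m) (C := 16)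
  (I := fun i s2 => reg s2 rCur = i /\ reg s2 rMinLast = min_last es i)).
- by rewrite eq1 /= /min_last big_nil; have [_ _ _ -> _] := edges 0 m0.
- move=> i s2 fr2 im [cur min_i].
  have edges2 : reg s2 rEdges = m.
    by rewrite (framed_reg fr2 rEdges) // (framed_reg fr1 rEdges).
  split; first by rewrite /= cur edges2; lia.
  have [_ _ _ last_i _] := edges i im; apply: runs_loop_free => //=.
  rewrite cur min_i (framed_arr fr2) // (framed_arr fr1) // last_i addn1 -minnE.
  by rewrite /min_last iota_rcons (big_rcons_AC _ _ _ _ minnA minnC).
- move=> s2 fr2 [cur min_m]; split=> //.
  by rewrite /= cur (framed_reg fr2 rEdges) // (framed_reg fr1 rEdges) // edges_m subnn.
- by rewrite /=; lia.
Qed.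

Definition seeded (c : seq nat) s :=
  [/\ reg s rTop = size c, reg s rBase = size c * 2 ^ m
    & forall j, j < size c ->
        [/\ arr s aOrigin j = nth 0 c j, arr s aVertex j = nth 0 c j,
            arr s aCode j = j * 2 ^ m & arr s aStamp j = 0]].

Lemma seeded_stored c s : seeded c s -> stored es c (search es c 0) s.
Proof.
move=> [top _ seeds]; split=> [|j]; rewrite size_map size_iota // => lt.
rewrite (nth_map 0) ?size_iota // nth_iota // add0n.
have [origin_j vertex_j code_j stamp_j] := seeds j lt; split=> //.
by rewrite code_j /code /= big_nil addn0.
Qed.

Lemma run_add_seed a c v s : seeded c s -> a < aOrigin ->
  arr s a (reg s rCur) = v -> reg s rWeight = 2 ^ m ->
  seeded (rcons c v) (run_loop_free (add_seed a) s).
Proof.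
move=> [top base seeds] a_lt cell weight.
have not_origin : (a == aOrigin) = false by apply/ltn_eqF.
rewrite /seeded size_rcons; split.
- by rewrite /= top addn1.
- by rewrite /= base weight mulSn addnC.
move=> j; rewrite ltnS leq_eqVlt nth_rcons => /orP[/eqP->|lt].
  by rewrite ltnn eqxx /= top eqxx not_origin /= cell base.
by rewrite lt /= top (ltn_eqF lt); exact: seeds.
Qed.

Lemma run_add_ends i c s : seeded c s -> reg s rCur = i ->
  arr s aEnd1 i = end1 es i -> arr s aEnd2 i = end2 es i -> reg s rWeight = 2 ^ m ->
  seeded (c ++ [:: end1 es i; end2 es i])
    (run_loop_free (add_seed aEnd1 ;; add_seed aEnd2) s).
Proof.
move=> seeds cur end1_i end2_i weight.
have fr := run_loop_free_framed s (isT : loop_free (add_seed aEnd1)).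
rewrite -cat1s catA !cats1; apply: run_add_seed => //.
- by apply: run_add_seed; rewrite ?cur.
- by rewrite (framed_reg fr rCur) // (framed_arr fr) // cur.
Qed.

Lemma runs_seed s : edges_upto m s -> reg s rEdges = m -> reg s rWeight = 2 ^ m ->
  reg s rMinLast = min_last es m -> reg s rTop = 0 -> reg s rBase = 0 ->
  runs seed s (m * 90 + 20) (seeded (candidates es (min_last es m) m)).
Proof.
move=> edges edges_m weight min_m top0 base0.
apply: (runs_seq_loop_free (T2 := m * 90 + 4)) => // [s1 fr1 eq1|];
  last by rewrite /=; lia.
apply: (runs_while_upto (n := m) (C := 80)
  (I := fun i s2 => reg s2 rCur = i /\ seeded (candidates es (min_last es m) i) s2)).
- by rewrite eq1; split=> //; split.
- move=> i s2 fr2 im [cur seeds].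
  have same x : x \in [:: rEdges; rWeight; rMinLast] -> reg s2 x = reg s x.
    by rewrite !inE => x_in; rewrite (framed_reg fr2) ?(framed_reg fr1) //= !inE; lia.
  split; first by rewrite /= cur same // edges_m; lia.
  have same_edge a j : a \in edge_arrays -> arr s2 a j = arr s a j.
    by rewrite !inE => a_in; rewrite (framed_arr fr2) ?(framed_arr fr1) //= !inE; lia.
  have [end1_i end2_i first_i _ _] := edges i im.
  apply: (runs_seq (T1 := 76) (T2 := 4)
    (Q1 := seeded (candidates es (min_last es m) i.+1))) => //; last first.
    move=> s3 fr3 seeds3; apply: runs_loop_free => //; split=> //.
    by rewrite /= (framed_reg fr3 rCur) // cur addn1.
  rewrite candidatesS; apply: (runs_if (T := 70)) => //=;
    rewrite cur same_edge // first_i same // min_m.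
    by rewrite subn_eq0 => /negbTE->; rewrite cats0; exact: runs_loop_free.
  move/eqP; rewrite subn_eq0 => ->; apply: runs_loop_free => //.
  by apply: (run_add_ends seeds cur); rewrite ?same_edge // same.
- move=> s2 fr2 [cur seeds]; split=> //.
  by rewrite /= cur (framed_reg fr2 rEdges) // (framed_reg fr1 rEdges) // edges_m subnn.
- by rewrite /=; lia.
Qed.

End Seed.

(** * The decision procedure *)

Definition main_program :=
  Assign rEdges (Read aInput (Const 1)) ;;
  If (Reg rEdges) (parse ;; If (Reg rBad) Skip decide)
    (Assign rResult (Read aInput (Const 0))).

Section Decide.

Variables (es : seq (nat * nat * seq nat)) (D N : nat).

Local Notation m := (size es).
Local Notation edges_upto := (edges_upto es).
Local Notation starts := (candidates es (min_last es m) m).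

Hypothesis times_uniq : forall i, i < m -> uniq (times es i).
Hypothesis span_le : forall i, i < m -> last_time es i - first_time es i <= D.
Hypothesis last_lt : forall i, i < m -> last_time es i < N.
Hypothesis loopless : forall i, i < m -> end1 es i != end2 es i.

Definition decide_time :=
  m * 110 + sweep_time es starts D + max_records starts D * 30 + 60.

Lemma parsed_loaded s : parsed es m s -> loaded es s.
Proof. by move=> [_ [edges _ _ [ls _]] _]; split=> // t; have [] := ls t. Qed.

Lemma runs_decide s : 0 < m -> parsed es m s -> (forall c, arr s aSeen c = 0) ->
  {in [:: rTop; rBase; rResult], forall x, reg s x = 0} ->
  runs decide s decide_time (fun s' =>
    accepting s' <-> exists x w, eulerian_trail es x w).
Proof.
move=> m0 pars unseen regs0; have ld := parsed_loaded pars.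
have [[_ edges_m _] [_ [weight _ hor] _ _] feas] := pars.
have cover_le t := feasible_coverage_le span_le t (leqnn m) feas.
apply: (runs_seq (T2 := decide_time - m * 20 - 20) (runs_find_min ld.1 edges_m m0));
  last by rewrite /decide_time; lia.
move=> s1 fr1 min1; have ld1 := framed_supported (@loaded_supported _) fr1 isT ld.
have seeding : runs seed s1 (m * 90 + 20) (seeded es starts).
  by apply: (runs_seed ld1.1 _ _ min1); rewrite (framed_reg fr1) // regs0.
apply: (runs_seq (T2 := decide_time - m * 110 - 40) seeding);
  last by rewrite /decide_time; lia.
move=> s2 fr2 seeds2; have ld2 := framed_supported (@loaded_supported _) fr2 isT ld1.
apply: (runs_seq (T2 := max_records starts D * 30 + 4)
  (runs_sweep span_le cover_le loopless feas.1 ld2 _ (seeded_stored seeds2) _)).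
- by rewrite (framed_reg fr2 rHorizon) // (framed_reg fr1 rHorizon).
- by move=> c; rewrite (framed_arr fr2) // (framed_arr fr1).
- move=> s3 fr3 sw3.
  have result0 : reg s3 rResult = 0.
    by rewrite (framed_reg fr3 rResult) // (framed_reg fr2 rResult) //
      (framed_reg fr1 rResult) // regs0.
  apply: runs_weaken (runs_accept cover_le loopless feas.1 sw3 result0) _ (leqnn _).
  move=> s4 _ ->; apply: iff_sym; exact: search_correct m0 loopless feas.1.
- by rewrite /decide_time; lia.
Qed.

Local Notation E := (2 ^ D).

Lemma double_succ_le : D.*2.+1 <= 2 * E.
Proof. by have := ltn_expl D (isT : 1 < 2); lia. Qed.

Lemma process_time_le : process_time D + 4 <= 604 * E ^ 2.
Proof.
have D_lt := ltn_expl D (isT : 1 < 2); rewrite /process_time expnS expn1.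
have : D.*2.+1 * (22 * D + 40) <= 2 * E * (40 * E).
  by apply: leq_mul double_succ_le _; lia.
have : D.*2.+1 * (22 * D + 200) <= 2 * E * (200 * E).
  by apply: leq_mul double_succ_le _; lia.
have : 0 < E * E by rewrite muln_gt0 expn_gt0.
lia.
Qed.

Lemma max_records_le : feasible es m -> max_records starts D <= 8 * E ^ 3.
Proof.
move=> feas; have size_starts : size starts <= 2 * (2 * E).
  apply: leq_trans (size_candidates _ _) _; rewrite -mul2n leq_mul2l.
  exact: leq_trans (feasible_coverage_le span_le _ (leqnn m) feas) double_succ_le.
apply: leq_trans (leq_mul size_starts (leqnn _)) _.
rewrite (_ : 2 ^ D.*2.+1 = 2 * E ^ 2); last by rewrite expnS -muln2 expnM.
by rewrite (expnS _ 2); lia.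
Qed.

Lemma max_edges_le : max_edges D N <= 2 * (E * N).
Proof. by rewrite /max_edges mulnC mulnA leq_mul2r double_succ_le orbT. Qed.

Definition total_time := 2 ^ 13 * (E ^ 5 * N).

Lemma parse_time_le : 0 < N -> parse_time D N <= 1000 * (E ^ 2 * N).
Proof.
move=> N0; have D_lt := ltn_expl D (isT : 1 < 2).
have E0 : 0 < E by rewrite expn_gt0.
have EN0 : 0 < E * N by rewrite muln_gt0 E0.
have : (max_edges D N).+1 * (edge_time D + 4) <= 3 * (E * N) * (244 * E).
  by apply: leq_mul; rewrite ?/edge_time; have := max_edges_le; lia.
have : 0 < E * (E * N) by rewrite muln_gt0 E0.
by rewrite /parse_time expnS expn1 -mulnA; lia.
Qed.

Lemma sweep_time_le : 0 < N -> feasible es m ->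
  sweep_time es starts D <= 5000 * (E ^ 5 * N).
Proof.
move=> N0 feas; have hor_le : horizon es m <= N.
  by apply/bigmax_leqP => i _; apply: last_lt.
have body_le := leq_mul (max_records_le feas) process_time_le.
have E5 : E ^ 5 = E ^ 3 * E ^ 2 by rewrite -expnD.
have E5_gt0 : 0 < E ^ 5 by rewrite !expn_gt0.
have : horizon es m * (max_records starts D * (process_time D + 4) + 14) <=
    N * (4846 * E ^ 5).
  by apply: leq_mul hor_le _; rewrite E5; rewrite E5 in E5_gt0; lia.
have : 0 < E ^ 5 * N by rewrite muln_gt0 E5_gt0.
by rewrite /sweep_time; lia.
Qed.

Lemma pow_mul_le a : 0 < N -> a <= 5 -> E ^ a * N <= E ^ 5 * N.
Proof. by move=> N0 a5; rewrite leq_mul2r leq_pexp2l ?orbT // expn_gt0. Qed.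

Lemma main_time_le : 0 < N -> feasible es m ->
  parse_time D N + decide_time + 20 <= total_time.
Proof.
move=> N0 feas; rewrite /total_time /decide_time.
have parse_le := parse_time_le N0; have sweep_le := sweep_time_le N0 feas.
have m_le := leq_trans (feasible_le span_le last_lt (leqnn m) feas) max_edges_le.
have records_le : max_records starts D <= 8 * (E ^ 3 * N).
  apply: leq_trans (max_records_le feas) _.
  by rewrite leq_mul2l leq_pmulr.
have pow1 := pow_mul_le N0 (isT : 1 <= 5); rewrite expn1 in pow1.
have pow2 := pow_mul_le N0 (isT : 2 <= 5); have pow3 := pow_mul_le N0 (isT : 3 <= 5).
have pow0 : 0 < E ^ 5 * N by rewrite muln_gt0 !expn_gt0.
move: parse_le sweep_le m_le records_le pow1 pow2 pow3 pow0.
move: (E ^ 5 * N) (E ^ 3 * N) (E ^ 2 * N) (E * N) => P5 P3 P2 P1.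
move: (parse_time D N) (sweep_time es starts D) (max_records starts D) m => p s r n.
by clear; lia.
Qed.

Lemma parse_time_total : 0 < N -> parse_time D N + 20 <= total_time.
Proof.
move=> N0; have := parse_time_le N0; have := pow_mul_le N0 (isT : 2 <= 5).
have : 0 < E ^ 5 * N by rewrite muln_gt0 !expn_gt0.
rewrite /total_time; move: (E ^ 5 * N) (E ^ 2 * N) (parse_time D N) => P5 P2 p.
by clear; lia.
Qed.

Lemma runs_main_edgeless n w : 0 < N ->
  runs main_program (initial_state [:: n, 0 & w]) total_time
    (fun s => accepting s <-> 0 < n).
Proof.
move=> N0; have T_ge := parse_time_total N0.
apply: (runs_seq_loop_free (T2 := 8)) => // [s1 _ ->|]; last by rewrite /=; lia.
apply: (runs_if (T := 4)) => //= _.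
by apply: runs_loop_free => //; rewrite /accepting /= lt0n.
Qed.

Lemma runs_main_program n : 0 < N -> 0 < m ->
  runs main_program (initial_state [:: n, m & words_from es 0]) total_time
    (fun s => accepting s <-> exists x w, eulerian_trail es x w).
Proof.
move=> N0 m0; have T_ge := parse_time_total N0; set s := initial_state _.
apply: (runs_seq_loop_free (T2 := total_time - 3)) => // [s1 fr1 eq1|];
  last by rewrite /=; lia.
have edges1 : reg s1 rEdges = m by rewrite eq1.
have fresh1 : fresh s1.
  split=> [x ne|a i ne]; first by rewrite (framed_reg fr1) ?inE.
  by rewrite (framed_arr fr1) //= (negbTE ne).
have inp1 : input_at 2 (words_from es 0) s1 by move=> j; rewrite (framed_arr fr1).
apply: (runs_if (T := total_time - 5)); rewrite /= ?edges1; last by lia.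
  move=> _; apply: (runs_seq (T2 := total_time - 5 - parse_time D N)
    (runs_parse times_uniq span_le last_lt fresh1 edges1 inp1)); last by lia.
  move=> s2 fr2 [pars|[bad [k k_le infeas]]].
  - have [[_ _ bad2] _ feas] := pars; have dec_le := main_time_le N0 feas.
    apply: (runs_if (T := decide_time)) => /=; rewrite ?bad2 //; last by lia.
    move=> _; apply: runs_decide => // [c|x x_in].
      by rewrite (framed_arr fr2) //; apply: fresh1.2.
    by rewrite (framed_reg fr2) ?fresh1.1 //; move: x_in; rewrite !inE; lia.
  - apply: (runs_if (T := 1)) => /= [_|bad0|]; last by lia.
      apply: runs_loop_free => //=; rewrite /accepting (framed_reg fr2 rResult) //.
      rewrite fresh1.1 // eqxx; split=> // -[x [w euler]].
      by case: infeas; exact: eulerian_trail_feasible euler k_le.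
    by rewrite bad0 in bad.
by move=> m_eq0; rewrite m_eq0 in m0.
Qed.

End Decide.

Lemma words_numbered (V : finType) (num : V -> nat) (rs : seq (V * V * seq nat)) :
  words_from (numbered num rs) 0 = flatten (map (encode_edge num) rs).
Proof. by rewrite /words_from drop0 /numbered -map_comp. Qed.

Lemma total_time_le k u n :
  total_time (k * u) n.+1 <= 2 ^ (14 * (k * u) + 14) * maxn 1 n.
Proof.
rewrite /total_time -expnM.
apply: (@leq_trans (2 ^ 13 * (2 ^ (k * u * 5) * (2 ^ 1 * maxn 1 n)))).
  by do 2!apply: leq_mul => //; lia.
by rewrite !mulnA -!expnD leq_mul2r leq_exp2l //; apply/orP; right; lia.
Qed.

Lemma main_program_correct (V : finType) (G : temporal_graph V) (k u : nat)
    (input : seq nat) :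
  temp_euler_instance G k -> consecutive_gaps_at_most G u -> encodes G input ->
  runs main_program (initial_state input) (total_time (k * u) (lifetime G).+1)
    (fun s => accepting s <-> temporally_eulerian G).
Proof.
move=> few_times small_gaps [num [rs [[num_inj _] rs_edges rs_times ->]]].
rewrite -words_numbered -(size_map (fun r => (num r.1.1, num r.1.2, r.2)) rs).
rewrite -/(numbered num rs); set es := numbered num rs.
case: (posnP (size es)) => [es0|es_gt0].
  rewrite es0; apply: runs_weaken (runs_main_edgeless _ _ _ _) _ (leqnn _) => // s _ ->.
  by apply: iff_sym; apply: temporally_eulerian_no_edge es0.
apply: runs_weaken (runs_main_program _ _ _ _ _ _ _) _ (leqnn _) => //
  [i im|i im|i im|i im|s _ ->].
- exact: numbered_times_uniq rs_times _ im.
- exact: numbered_span_le rs_edges rs_times _ _ _ few_times small_gaps im.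
- exact: last_time_le_lifetime rs_edges rs_times _ im.
- exact: numbered_loopless num_inj rs_edges _ im.
- exact: iff_sym (temporally_eulerianE num_inj rs_edges rs_times es_gt0).
Qed.

Theorem theorem5p4 :
  exists (P : program) (c : nat),
  forall (V : finType) (G : temporal_graph V) (k u : nat),
    temp_euler_instance G k ->
    consecutive_gaps_at_most G u ->
    forall input : seq nat, encodes G input ->
    decides_within P input
      (2 ^ (c * (k * u) + c) * maxn 1 (lifetime G))
      (temporally_eulerian G).
Proof.
exists main_program, 14 => V G k u few_times small_gaps input enc.
have run := main_program_correct few_times small_gaps enc.
exact: runs_weaken run (fun _ _ accepts => accepts) (total_time_le _ _ _).
Qed.
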